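(* Let $n\ge 3$ and let $M^n$ be a connected smooth $n$-manifold. Suppose that $\phi: M^n\to\mathbb{H}^{n+1}$ is a properly immersed, complete, uniformly horospherically convex hypersurface whose Gauss map $G:M^n\to\mathbb{S}^n$ is regular at infinity, and suppose that the boundary at infinity $\partial_\infty\phi(M^n)\subset\mathbb{S}^n$ has Hausdorff dimension less than $n-2$. Then the Gauss map $G:M^n\to\mathbb{S}^n$ is injective.
   Context: $\mathbb{R}^{1,n+1}$ is $\mathbb{R}^{n+2}$ with $\langle\bar x,\bar x\rangle=-x_0^2+\sum_{i=1}^{n+1}x_i^2$, and $\mathbb{H}^{n+1}=\{\bar x:\langle\bar x,\bar x\rangle=-1,\ x_0>0\}$. The ideal boundary of $\mathbb{H}^{n+1}$ is the unit sphere $\mathbb{S}^n$, where $x\in\mathbb{S}^n$ corresponds to the null ray through $(1,x)$. An immersed hypersurface $\phi:M^n\to\mathbb{H}^{n+1}$ is oriented by a unit normal field $\eta$, viewed as a map into $\{\bar x:\langle\bar x,\bar x\rangle=1\}$; its principal curvatures $\kappa_i$ are defined by $d\eta(e_i)=-\kappa_i\,d\phi(e_i)$ in an orthonormal basis of principal directions. ''Complete'' means that the induced metric on $M^n$ is complete. $\phi$ is uniformly horospherically convex if there is a number $\kappa_0<1$ such that all principal curvatures at all points of $M^n$ are $\le\kappa_0$. The Gauss map $G:M^n\to\mathbb{S}^n$ sends $p$ to the point at infinity of the unique horosphere through $\phi(p)$ whose inner unit normal at $\phi(p)$ is $\eta(p)$; equivalently $\phi+\eta=e^{\tilde\rho}(1,G)$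 for a function $\tilde\rho$ on $M^n$. The boundary at infinity $\partial_\infty\phi(M^n)\subset\mathbb{S}^n$ is the set of $x\in\mathbb{S}^n$ that are limits, in the Euclidean topology of the closed ball $\overline{\mathbb{B}^{n+1}}$, of sequences of points of the hypersurface in the Poincaré ball model $\mathbb{B}^{n+1}$. The Gauss map of a properly immersed hypersurface is regular at infinity if for each $p\in\partial_\infty\phi(M^n)$ and each sequence $q_i\in M^n$ with $\phi(q_i)\to p$ one has $\lim_{i\to\infty}G(q_i)=p$. *)

(* Defs.v *)
From HB Require Import structures.
From mathcomp Require Import all_boot all_order all_algebra.
From mathcomp Require Import all_classical all_reals all_analysis.

Set Implicit Arguments.
Unset Strict Implicit.
Unset Printing Implicit Defensive.

Import Order.TTheory GRing.Theory Num.Theory.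
Import numFieldNormedType.Exports.

Local Open Scope classical_set_scope.
Local Open Scope ring_scope.

(* C^infinity on an open set U: all iterated directional derivatives of f exist
   and are (Frechet) differentiable at every point of U. *)
Definition smooth_on (R : realType) (V W : normedModType R)
    (U : set V) (f : V -> W) : Prop :=
  forall (vs : seq V) (x : V), U x ->
    differentiable (foldr (fun v g => 'D_v g) f vs) x.

(* [chart_map] and [chart_inv] are total functions; only their restrictions to
   [chart_dom] and to [chart_image] are meaningful. *)
Record chart (R : realType) (n : nat) (M : topologicalType) := Chart {
  chart_dom : set M ;
  chart_map : M -> 'rV[R]_n ;
  chart_inv : 'rV[R]_n -> M ;
  chart_image := chart_map @` chart_dom ;
  chart_dom_open : open chart_dom ;
  chart_image_open : open chart_image ;
  chart_mapK : forall p, chart_dom p -> chart_inv (chart_map p) = p ;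
  chart_map_continuous : {within chart_dom, continuous chart_map} ;
  chart_inv_continuous : {within chart_image, continuous chart_inv} }.

Definition smooth_atlas (R : realType) (n : nat) (M : topologicalType)
    (A : set (chart R n M)) : Prop :=
  (forall p, exists2 c, A c & chart_dom c p) /\
  (forall c d, A c -> A d ->
     smooth_on (chart_map c @` (chart_dom c `&` chart_dom d))
               (chart_map d \o chart_inv c)).

Definition smooth_manifold (R : realType) (n : nat) (M : topologicalType)
    (A : set (chart R n M)) : Prop :=
  [/\ hausdorff_space M, @second_countable M & smooth_atlas A].

Section SmoothMaps.
Context (R : realType) (n : nat) (M : topologicalType) (A : set (chart R n M)).

Definition smooth_map (W : normedModType R) (f : M -> W) : Prop :=
  forall c, A c -> smooth_on (chart_image c) (f \o chart_inv c).

(* A smooth curve on [0, 1] is given by a smooth extension to the whole line. *)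
Definition smooth_curve (g : R -> M) : Prop :=
  continuous g /\
  forall c, A c -> smooth_on (g @^-1` chart_dom c) (chart_map c \o g).

(* The differential of f at p, read in the chart c around p. *)
Definition diff_in (W : normedModType R) (c : chart R n M) (f : M -> W) (p : M)
    (v : 'rV[R]_n) : W :=
  'd (f \o chart_inv c) (chart_map c p) v.

End SmoothMaps.

Section Hyperbolic.
Context (R : realType) (n : nat).

(* A vector of R^{1,n+1} is split into its coordinate x_0 and its spatial part
   (x_1, ..., x_{n+1}). *)
Definition time_part (x : 'rV[R]_n.+2) : R := x 0 ord0.
Definition space_part (x : 'rV[R]_n.+2) : 'rV[R]_n.+1 :=
  \row_(i < n.+1) x 0 (lift ord0 i).

Definition edot m (x y : 'rV[R]_m) : R := \sum_(i < m) x 0 i * y 0 i.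

(* The library norm on row vectors is the sup norm; this is the Euclidean one. *)
Definition enorm m (x : 'rV[R]_m) : R := Num.sqrt (edot x x).

Definition lorentz (x y : 'rV[R]_n.+2) : R :=
  - (time_part x * time_part y) + edot (space_part x) (space_part y).

Definition hyperbolic_space : set 'rV[R]_n.+2 :=
  [set x | lorentz x x = -1 /\ 0 < time_part x].

Definition sphere : set 'rV[R]_n.+1 := [set x | enorm x = 1].

(* Stereographic projection from -(1, 0) onto the unit ball, identifying the
   hyperboloid with the Poincare ball. *)
Definition poincare_ball (x : 'rV[R]_n.+2) : 'rV[R]_n.+1 :=
  (1 + time_part x)^-1 *: space_part x.

(* The vector (1, x). *)
Definition null_vector (x : 'rV[R]_n.+1) : 'rV[R]_n.+2 :=
  \row_(i < n.+2) if unlift ord0 i is Some j then x 0 j else 1.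

End Hyperbolic.

Section Hypersurface.
Context (R : realType) (n : nat) (M : topologicalType) (A : set (chart R n M)).
Context (phi eta : M -> 'rV[R]_n.+2).

Definition immersion : Prop :=
  [/\ forall p, hyperbolic_space (phi p),
      smooth_map A phi &
      forall c p, A c -> chart_dom c p -> injective (diff_in c phi p)].

(* The normal is tangent to hyperbolic space, hence orthogonal to phi. *)
Definition unit_normal_field : Prop :=
  smooth_map A eta /\
  forall p, [/\ lorentz (eta p) (eta p) = 1,
                lorentz (eta p) (phi p) = 0 &
                forall c v, A c -> chart_dom c p ->
                  lorentz (eta p) (diff_in c phi p v) = 0].

(* Properness as a map into hyperbolic space, which carries the subspace
   topology. *)
Definition proper_in_hyperbolic_space : Prop :=
  forall K : set 'rV[R]_n.+2,
    K `<=` @hyperbolic_space R n -> compact K -> compact (phi @^-1` K).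

Definition curve_length (g : R -> M) : R :=
  let g' := 'D_1 (phi \o g) in
  Rintegral lebesgue_measure `[0, 1] (fun t => Num.sqrt (lorentz (g' t) (g' t))).

(* p and q are joined by a piecewise smooth curve of length l, given as a chain
   of smooth pieces each parametrized by [0, 1]. *)
Inductive joined_by_length (q : M) : M -> R -> Prop :=
| joined_refl : joined_by_length q q 0
| joined_step (g : R -> M) (l : R) :
    smooth_curve A g -> joined_by_length q (g 1) l ->
    joined_by_length q (g 0) (curve_length g + l).

Definition induced_distance (p q : M) : R := inf [set l | joined_by_length q p l].

Definition complete_induced_metric : Prop :=
  forall u : nat -> M,
    (forall e : R, 0 < e -> exists N : nat, forall i j : nat,
       (N <= i)%N -> (N <= j)%N -> induced_distance (u i) (u j) < e) ->
    exists p, induced_distance (u k) p @[k --> \oo] --> (0 : R).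

(* kappa lists the principal curvatures at p, in an orthonormal basis e of
   principal directions (for the induced metric). *)
Definition principal_curvatures (c : chart R n M) (p : M) (kappa : 'I_n -> R) :
    Prop :=
  exists e : 'I_n -> 'rV[R]_n,
    (forall i j,
       lorentz (diff_in c phi p (e i)) (diff_in c phi p (e j)) = (i == j)%:R) /\
    (forall i, diff_in c eta p (e i) = - kappa i *: diff_in c phi p (e i)).

Definition uniformly_horospherically_convex : Prop :=
  exists2 kappa0 : R, kappa0 < 1 &
    forall c p kappa, A c -> chart_dom c p -> principal_curvatures c p kappa ->
      forall i, kappa i <= kappa0.

(* The horospheres with point at infinity x are the level sets
   lorentz y (null_vector x) = - expR (- rho); the inner unit normal at y is
   expR rho *: null_vector x - y. *)
Definition is_gauss_map (G : M -> 'rV[R]_n.+1) : Prop :=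
  forall p, sphere (G p) /\
    exists rho : R, phi p + eta p = expR rho *: null_vector (G p).

Definition boundary_at_infinity : set 'rV[R]_n.+1 :=
  [set x | sphere x /\
    exists q : nat -> M, poincare_ball (phi (q k)) @[k --> \oo] --> x].

Definition regular_at_infinity (G : M -> 'rV[R]_n.+1) : Prop :=
  forall p, boundary_at_infinity p ->
  forall q : nat -> M, poincare_ball (phi (q k)) @[k --> \oo] --> p ->
    G (q k) @[k --> \oo] --> p.

End Hypersurface.

Section Hausdorff.
Context (R : realType) (m : nat).
Local Open Scope ereal_scope.

(* The element 0 makes the diameter of the empty set 0 rather than -oo. *)
Definition diam (U : set 'rV[R]_m) : \bar R :=
  ereal_sup (0 |` [set z | exists x y, [/\ U x, U y & z = (enorm (x - y))%:E]]).

Definition hausdorff_premeasure (s delta : R) (B : set 'rV[R]_m) : \bar R :=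
  ereal_inf [set \sum_(0 <= k <oo) (diam (U k) `^ s) |
             U in [set U : nat -> set 'rV[R]_m |
                   B `<=` \bigcup_k U k /\ forall k, diam (U k) <= delta%:E]].

Definition hausdorff_measure (s : R) (B : set 'rV[R]_m) : \bar R :=
  ereal_sup [set hausdorff_premeasure s delta B | delta in [set d : R | (0 < d)%R]].

(* Restricting to s > 0 does not change the infimum and avoids the convention
   0 `^ 0 = 1; the empty set gets dimension 0. *)
Definition hausdorff_dim (B : set 'rV[R]_m) : \bar R :=
  ereal_inf [set s%:E | s in [set s : R | (0 < s)%R /\ hausdorff_measure s B = 0]].

End Hausdorff.

(* Main.v *)
(* Put L := phi + eta = exp(rho) (1, G) and let E be the boundary at infinity.
   Since all principal curvatures are < 1, dL = (1 - kappa_i) dphi on principal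
   directions is injective and spacelike, so that (t, p) |-> t * space_part (L p)
   is a local diffeomorphism and G is a local homeomorphism.  Regularity at
   infinity and properness of phi make G proper over the complement of E.

   Fix z = G p0 outside E, and let S be the shadow that the cone over E casts when
   it is illuminated from z.  Segments from z which avoid the cone lift from p0, so
   G has a section s over the complement of S with s z = p0; its image is open and
   closed in G^-1 (~ S).  The shadow has dimension < n - 1: two points of a ball
   outside S can be joined by a broken segment a, c, b outside S, since the bad
   choices of c lie in {r e + al z + be a : e in E}, a set of zero content because
   H^s(E) = 0 for some s < n - 2.  Hence S does not disconnect M, the image of s is
   all of G^-1 (~ S), and G is injective there; by density it is injective. *)
Require Import Defs.
From HB Require Import structures.
From mathcomp Require Import all_boot all_order all_algebra.
From mathcomp Require Import all_classical all_reals all_analysis.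
From mathcomp Require Import ring lra.

Set Implicit Arguments.
Unset Strict Implicit.
Unset Printing Implicit Defensive.

Import Order.TTheory GRing.Theory Num.Theory.
Import numFieldNormedType.Exports.

Local Open Scope classical_set_scope.
Local Open Scope ring_scope.

(** * Sets of zero content *)

(** The obstacle is monodromy: over the complement of [E] the map [G] is only a proper local
    homeomorphism, and uniqueness of lifts would call for simple connectivity of that complement.
    Lifting only along segments from [z] avoids this: the liftable points form a star-shaped set
    about [z], and two lifts on a convex set agree once they agree at one point. What remains is a
    non-separation statement, obtained by counting grid points. To have straight segments,
    everything is moved from the sphere to its ambient vector space.

    The bound n - 2 comes from counting parameters. A bad [c] is r e + al z + be a with three free
    coefficients, so zero content of [E] in exponent p = n - 2 gives zero content of the bad set in
    exponent p + 3 = n + 1, the dimension of the ambient space, and such a set contains no ball.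
    Finite covers suffice because [E] is compact, but they only reach bounded sets; hence the
    explicit bounds on al, r and 1/t. *)

Lemma rV_norm_le (R : realType) m (x : 'rV[R]_m) (e : R) : 0 <= e ->
  (`|x| <= e) <-> (forall i, `|x 0 i| <= e).
Proof.
move=> e0; rewrite /Num.Def.normr /= mx_normrE; split.
  move=> h i; apply: le_trans h.
  exact: (le_bigmax (0 : R) (fun ij : 'I_1 * 'I_m => `|x ij.1 ij.2|) (0, i)).
move=> h; apply: bigmax_le => // -[i j] _ /=; rewrite ord1; exact: h.
Qed.

Lemma rV_norm_lt (R : realType) m (x : 'rV[R]_m) (e : R) : 0 < e ->
  (`|x| < e) <-> (forall i, `|x 0 i| < e).
Proof.
move=> e0; rewrite /Num.Def.normr /= mx_normrE; split.
  move=> h i; apply: le_lt_trans h.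
  exact: (le_bigmax (0 : R) (fun ij : 'I_1 * 'I_m => `|x ij.1 ij.2|) (0, i)).
move=> h; apply: bigmax_lt => // -[i j] _ /=; rewrite ord1; exact: h.
Qed.

Lemma rV_coord_le (R : realType) m (x : 'rV[R]_m) i : `|x 0 i| <= `|x|.
Proof. exact: (proj1 (rV_norm_le x (normr_ge0 x)) (lexx _)). Qed.

Section NullContent.
Context (R : realType) (m : nat).
Implicit Types (T : set 'rV[R]_m) (l : seq ('rV[R]_m * R)).

(** Covers are finite and made of sup-norm balls, that is cubes: finiteness allows one grid fine
    enough for all of them, and positive radii allow division. *)
Definition null_content (p : nat) T := forall e : R, 0 < e ->
  exists l, [/\ forall x, T x -> exists2 q, q \in l & `|x - q.1| <= q.2,
                forall q, q \in l -> 0 < q.2 &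
                \sum_(q <- l) q.2 ^+ p < e].

Lemma null_contentU p T1 T2 :
  null_content p T1 -> null_content p T2 -> null_content p (T1 `|` T2).
Proof.
move=> h1 h2 e e0; have e20 : 0 < e / 2 by rewrite divr_gt0.
have [l1 [c1 p1 s1]] := h1 _ e20; have [l2 [c2 p2 s2]] := h2 _ e20.
exists (l1 ++ l2); split.
- by move=> x [/c1|/c2] [q ql qx]; exists q => //; rewrite mem_cat ql ?orbT.
- by move=> q; rewrite mem_cat => /orP[/p1|/p2].
- by rewrite big_cat /= [e]splitr ltrD.
Qed.

Lemma card_ord_cluster K (P : pred 'I_K) (w : nat) :
  (forall i j, P i -> P j -> (i <= j + w)%N) -> (#|P| <= w.+1)%N.
Proof.
move=> h; have [/existsP[i0 Pi0]|] := boolP [exists i, P i]; last first.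
  rewrite negb_exists => /forallP h0.
  by rewrite eq_card0 // => i; apply/negbTE; exact: h0.
have [j Pj minj] := arg_minnP (fun i : 'I_K => i : nat) Pi0.
rewrite -(size_iota j w.+1) cardE -(size_map val).
apply: uniq_leq_size; first by rewrite map_inj_uniq ?enum_uniq //; exact: val_inj.
move=> k /mapP[i]; rewrite mem_enum => Pi ->.
rewrite mem_iota minj //= addnS ltnS; exact: h.
Qed.

(** The indices hit spread over at most 2 rho K / h, so there is at most one more of them than that;
    the last hypothesis absorbs the extra one and turns the factor 2 into 4. *)
Lemma card_grid_ball (h rho : R) K (c q : R) : 0 < h -> (0 < K)%N ->
    h <= 2 * rho * K%:R ->
  (#|[pred j : 'I_K | `|c + h / K%:R * j%:R - q| <= rho]|)%:R
    <= 4 * rho * K%:R / h.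
Proof.
move=> h0 K0 hr; have K0' : 0 < K%:R :> R by rewrite ltr0n.
set w := Num.truncn (2 * rho * K%:R / h).
have wge : 0 <= 2 * rho * K%:R / h by rewrite divr_ge0 ?(ltW h0) // (le_trans (ltW h0)).
have /andP[w1 w2] : (w%:R <= 2 * rho * K%:R / h < w.+1%:R)%R.
  by rewrite truncn_itv.
apply: (@le_trans _ _ w.+1%:R).
  rewrite ler_nat; apply: card_ord_cluster => i j /= hi hj.
  rewrite -ltnS -addnS -(ltr_nat R) natrD -ltrBlDl; apply: le_lt_trans w2.
  rewrite ler_pdivlMr //.
  have : h / K%:R * (i%:R - j%:R) <= 2 * rho.
    move: hi hj; rewrite !ler_norml => /andP[_ a1] /andP[a2 _].
    lra.
  rewrite -(ler_pM2r K0').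
  suff -> : h / K%:R * (i%:R - j%:R) * K%:R = (i%:R - j%:R) * h :> R by [].
  by field; rewrite gt_eqF.
rewrite -addn1 natrD.
have : 1 <= 2 * rho * K%:R / h by rewrite ler_pdivlMr // mul1r.
lra.
Qed.

(* A ball of radius [rho] contains at most [(4 rho K / h) ^ m] of the [K ^ m]
   points of a grid of mesh [h / K], once [K] is large. *)
Lemma null_content_avoid T (c0 : 'rV[R]_m) (h : R) :
  null_content m T -> 0 < h -> exists c, `|c - c0| < h /\ ~ T c.
Proof.
move=> T0 h0; apply: contrapT => hc.
have cov c : `|c - c0| < h -> T c.
  by move=> hcc; apply: contrapT => nT; apply: hc; exists c.
(* If the sum of the [q.2 ^+ m] is below this threshold, the total count of (4 q.2 K / h)^m is below
   K^m, the number of grid points. *)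
have e0 : 0 < (h / 4) ^+ m by rewrite exprn_gt0 // divr_gt0.
have [l [covl posl suml]] := T0 _ e0.
have [K K0 KP] : exists2 K : nat, (0 < K)%N & forall q, q \in l -> h <= 2 * q.2 * K%:R.
  elim: l posl {covl suml} => [|q l IH] hl; first by exists 1%N.
  have [|K K0 KP] := IH; first by move=> q' q'l; apply: hl; rewrite inE q'l orbT.
  have q0 : 0 < q.2 by apply: hl; rewrite inE eqxx.
  have : 0 <= h / (2 * q.2) by rewrite divr_ge0 ?ltW // mulr_gt0.
  move=> /truncn_itv /andP[_]; set k := Num.truncn _ => hk.
  exists (maxn K k.+1); first by rewrite leq_max K0.
  move=> q'; rewrite inE => /orP[/eqP ->|q'l].
    move: hk; rewrite ltr_pdivrMr ?mulr_gt0 // => hk.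
    apply: (le_trans (ltW hk)); rewrite mulrC ler_pM2l ?mulr_gt0 //.
    by rewrite ler_nat leq_maxr.
  apply: (le_trans (KP _ q'l)); rewrite ler_pM2l.
    by rewrite ler_nat leq_maxl.
  by rewrite mulr_gt0 // hl // inE q'l orbT.
have K0' : 0 < K%:R :> R by rewrite ltr0n.
(* The grid fills only the corner c0 + [0, h)^m of the ball, which is enough for counting. *)
pose P (j : {ffun 'I_m -> 'I_K}) : 'rV[R]_m :=
  \row_i (c0 0 i + h / K%:R * (j i)%:R).
pose F (q : 'rV[R]_m * R) : {pred {ffun 'I_m -> 'I_K}} :=
  family (fun i => [pred j : 'I_K | `|c0 0 i + h / K%:R * j%:R - q.1 0 i| <= q.2]).
have cF j : exists2 q, q \in l & j \in F q.
  have [|q ql hq] := covl (P j).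
    apply: cov; apply/rV_norm_lt => // i; rewrite !mxE addrAC subrr add0r.
    rewrite ger0_norm ?mulr_ge0 ?divr_ge0 ?ler0n ?(ltW h0) //.
    rewrite mulrAC ltr_pdivrMr // ltr_pM2l // ltr_nat; exact: ltn_ord.
  exists q => //; apply/familyP => i; rewrite inE.
  apply: le_trans hq.
  have := rV_coord_le (P j - q.1) i; by rewrite !mxE.
have cardF : (#|{ffun 'I_m -> 'I_K}| <= \sum_(q <- l) #|F q|)%N.
  rewrite -sum1_card.
  apply: (@leq_trans (\sum_(j : {ffun 'I_m -> 'I_K}) \sum_(q <- l) (j \in F q))%N).
    apply: leq_sum => j _; have [q ql jF] := cF j.
    by rewrite (big_rem q) //= jF.
  rewrite exchange_big /=; apply: leq_sum => q _.
  by rewrite -sum1_card [X in (_ <= X)%N]big_mkcond /=; apply: leq_sum => j _; case: (j \in F q).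
have Fle q : q \in l -> (#|F q|)%:R <= (4 * q.2 * K%:R / h) ^+ m.
  move=> ql; rewrite card_family.
  rewrite [X in _ <= X](_ : _ = \prod_(i < m) (4 * q.2 * K%:R / h)); last first.
    by rewrite prodr_const card_ord.
  rewrite foldrE big_image /= natr_prod.
  apply: ler_prod => i _; rewrite ler0n /=; apply: card_grid_ball => //; exact: KP.
have : (K ^ m)%:R <= \sum_(q <- l) (4 * q.2 * K%:R / h) ^+ m.
  rewrite -{1}(card_ord K) -{1}(card_ord m) -card_ffun.
  apply: (@le_trans _ _ (\sum_(q <- l) #|F q|)%:R); first by rewrite ler_nat.
  rewrite natr_sum !big_seq; apply: ler_sum => q; exact: Fle.
have -> : \sum_(q <- l) (4 * q.2 * K%:R / h) ^+ m = (K%:R / (h / 4)) ^+ m * \sum_(q <- l) q.2 ^+ m.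
  rewrite mulr_sumr; apply: eq_bigr => q _; rewrite -exprMn; congr (_ ^+ _).
  by field; rewrite gt_eqF.
rewrite natrX expr_div_n mulrAC ler_pdivlMr // ler_pM2l ?exprn_gt0 //.
by move/le_lt_trans/(_ suml); rewrite ltxx.
Qed.

End NullContent.

(** * Covers given by a small Hausdorff dimension *)

(** While the parameter runs through [-N, N] in steps q, a ball of radius q produces at most 2N/q +
    1 balls of radius 2Cq: one parameter costs one exponent. The Lipschitz bound allows x' outside
    [T], within distance 1, since centres of a cover need not lie in [T]. *)
Lemma null_content_family (R : realType) m p (T : set 'rV[R]_m)
    (F : R -> 'rV[R]_m -> 'rV[R]_m) (N C : R) :
  (0 < p)%N -> 0 <= N -> 0 < C ->
  (forall r r' x x', `|r| <= N -> T x -> `|x - x'| <= 1 ->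
     `|F r x - F r' x'| <= C * (`|r - r'| + `|x - x'|)) ->
  null_content p T ->
  null_content p.+1 [set y | exists r x, [/\ `|r| <= N, T x & y = F r x]].
Proof.
move=> p0 N0 C0 lipF T0 e e0.
(* For q <= 1 one has (2N/q + 1)(2Cq)^(p+1) <= D q^p. *)
set D := (2 * N + 1) * (2 * C) ^+ p.+1.
have D0 : 0 < D.
  by rewrite mulr_gt0 ?exprn_gt0 ?mulr_gt0 // ltr_wpDl // mulr_ge0.
(* The minimum with 1 forces all radii to be at most 1. *)
have [|l [covl posl suml]] := T0 (Num.min 1 (e / D)).
  by rewrite lt_min ltr01 divr_gt0.
move: suml; rewrite lt_min => /andP[suml1 suml2].
have le1 q : q \in l -> q.2 <= 1.
  move=> ql; rewrite leNgt; apply/negP => q1.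
  have : q.2 ^+ p <= \sum_(q <- l) q.2 ^+ p.
    rewrite (big_rem q) //= lerDl big_seq sumr_ge0 // => q' q'l.
    by rewrite exprn_ge0 // ltW // posl // (mem_rem q'l).
  move/le_lt_trans/(_ suml1); rewrite ltNge; move/negP; apply.
  by rewrite exprn_ege1 // ltW.
pose K (q : 'rV[R]_m * R) := (Num.truncn (2 * N / q.2)).+1.
exists [seq (F (- N + j%:R * q.2) q.1, 2 * C * q.2) | q <- l, j <- iota 0 (K q)]; split.
- move=> _ [s [x [sN Tx ->]]].
  have [q ql xq] := covl _ Tx.
  have q0 := posl _ ql; have q1 := le1 _ ql.
  move: (sN); rewrite ler_norml => /andP[s1 s2].
  have t0 : 0 <= (s + N) / q.2 by rewrite divr_ge0 ?(ltW q0) //; lra.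
  set j := Num.truncn ((s + N) / q.2).
  have := truncn_itv t0; rewrite -/j => /andP[j1 j2].
  exists (F (- N + j%:R * q.2) q.1, 2 * C * q.2).
    apply/allpairsPdep; exists q, j; split => //.
    rewrite mem_iota /= add0n ltnS; apply: le_truncn.
    by rewrite ler_pM2r ?invr_gt0 //; lra.
  move: j1 j2; rewrite ler_pdivlMr // ltr_pdivrMr // => j1 j2 /=.
  apply: (le_trans (lipF _ _ _ _ sN Tx (le_trans xq q1))).
  rewrite [leRHS](_ : _ = C * (q.2 + q.2)); last by ring.
  rewrite ler_pM2l // lerD // ler_norml.
  move: j2; rewrite -addn1 natrD mulrDl mul1r => j2.
  apply/andP; split; lra.
- move=> _ /allpairsPdep[q [j [ql _ ->]]] /=.
  by rewrite !mulr_gt0 // posl.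
- rewrite big_allpairs_dep /=.
  apply: (@le_lt_trans _ _ (D * \sum_(q <- l) q.2 ^+ p)); last first.
    by rewrite mulrC -ltr_pdivlMr.
  rewrite mulr_sumr big_seq [leRHS]big_seq; apply: ler_sum => q ql.
  have q0 := posl _ ql; have q1 := le1 _ ql.
  rewrite big_const_seq count_predT -[size _]/(size (iota 0 (K q))) size_iota iter_addr_0 -[leLHS]mulr_natl.
  have -> : (2 * C * q.2) ^+ p.+1 = q.2 * ((2 * C) ^+ p.+1 * q.2 ^+ p).
    by rewrite exprMn [q.2 ^+ p.+1]exprS; ring.
  rewrite mulrA /D -[leRHS]mulrA; apply: ler_wpM2r.
    by rewrite mulr_ge0 // exprn_ge0 ?mulr_ge0 ?(ltW q0) ?(ltW C0).
  have t0 : 0 <= 2 * N / q.2 by rewrite divr_ge0 ?(ltW q0) // mulr_ge0.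
  have := truncn_itv t0 => /andP[j1 _].
  move: j1; rewrite ler_pdivlMr // => j1.
  by rewrite /K -addn1 natrD mulrDl mul1r lerD.
Qed.

(** * Euclidean norm compared with the sup norm *)

Section EuclideanNorm.
Context (R : realType) (m : nat).
Implicit Types x y z : 'rV[R]_m.

Lemma edotC x y : edot x y = edot y x.
Proof. by apply: eq_bigr => i _; rewrite mulrC. Qed.

Lemma edotDl x y z : edot (x + y) z = edot x z + edot y z.
Proof.
by rewrite /edot -big_split /=; apply: eq_bigr => i _; rewrite mxE mulrDl.
Qed.

Lemma edotZl (r : R) x y : edot (r *: x) y = r * edot x y.
Proof. by rewrite /edot mulr_sumr; apply: eq_bigr => i _; rewrite mxE mulrA. Qed.

Lemma edotZr (r : R) x y : edot x (r *: y) = r * edot x y.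
Proof. by rewrite edotC edotZl edotC. Qed.

Lemma edotDr x y z : edot z (x + y) = edot z x + edot z y.
Proof. by rewrite edotC edotDl !(edotC z). Qed.

Lemma edot_ge0 x : 0 <= edot x x.
Proof. by apply: sumr_ge0 => i _; rewrite -expr2 sqr_ge0. Qed.

Lemma edot_eq0 x : edot x x = 0 -> x = 0.
Proof.
move/eqP; rewrite psumr_eq0 => [/allP h|i _]; last by rewrite -expr2 sqr_ge0.
apply/rowP => i; have := h i (mem_index_enum _).
by rewrite /= mulf_eq0 orbb mxE => /eqP.
Qed.

Lemma enorm_ge0 x : 0 <= enorm x. Proof. exact: sqrtr_ge0. Qed.

Lemma sqr_enorm x : enorm x ^+ 2 = edot x x.
Proof. by rewrite sqr_sqrtr // edot_ge0. Qed.

Lemma enorm_gt0 x : x <> 0 -> 0 < enorm x.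
Proof.
move=> x0; rewrite lt_neqAle enorm_ge0 andbT eq_sym; apply/eqP => nx; apply: x0.
by apply: edot_eq0; rewrite -sqr_enorm nx expr0n.
Qed.

Lemma enormZ (r : R) x : enorm (r *: x) = `|r| * enorm x.
Proof.
by rewrite /enorm edotZl edotZr mulrA -expr2 sqrtrM ?sqr_ge0 // sqrtr_sqr.
Qed.

Lemma norm_le_enorm x : `|x| <= enorm x.
Proof.
apply/rV_norm_le => [|i]; first exact: enorm_ge0.
rewrite -(sqrtr_sqr (x 0 i)) ler_wsqrtr // /edot (bigD1 i) //= -expr2 lerDl.
by apply: sumr_ge0 => j _; rewrite -expr2 sqr_ge0.
Qed.

Lemma edot_le x : edot x x <= m%:R * `|x| ^+ 2.
Proof.
have -> : m%:R * `|x| ^+ 2 = \sum_(i < m) `|x| ^+ 2.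
  by rewrite sumr_const card_ord mulr_natl.
apply: ler_sum => i _; rewrite -expr2 -[x 0 i ^+ 2]real_normK ?num_real //.
by rewrite lerXn2r ?nnegrE // rV_coord_le.
Qed.

End EuclideanNorm.

Lemma sum_pow_half (R : realType) (N : nat) :
  \sum_(0 <= k < N) (2^-1 : R) ^+ k.+1 = 1 - 2^-1 ^+ N.
Proof.
elim: N => [|N IH]; first by rewrite big_geq // expr0 subrr.
by rewrite big_nat_recr //= IH exprS; field.
Qed.

Section HausdorffDim.
Context (R : realType) (m : nat).
Implicit Types E U : set 'rV[R]_m.

Lemma diam_ge0 U : (0 <= diam U)%E.
Proof. by apply: ereal_sup_ubound; left. Qed.

Lemma enorm_le_diam U x y : U x -> U y -> ((enorm (x - y))%:E <= diam U)%E.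
Proof. by move=> Ux Uy; apply: ereal_sup_ubound; right; exists x, y. Qed.

(** A vanishing measure gives arbitrarily small sums already at scale delta = 1; smallness of the
    sets is then read off from the sums. *)
Lemma hausdorff_dim_cover E (s : R) : (hausdorff_dim E < s%:E)%E ->
  exists t : R, [/\ 0 < t, t < s & forall e : R, 0 < e ->
    exists U : nat -> set 'rV[R]_m, [/\ E `<=` \bigcup_k U k,
      forall k, (diam (U k) <= 1)%E &
      (\sum_(0 <= k <oo) (diam (U k) `^ t) < e%:E)%E]].
Proof.
move=> /ereal_inf_lt[_ [t [t0 Ht] <-]]; rewrite lte_fin => ts.
exists t; split => // e e0.
have : (hausdorff_premeasure t 1 E < e%:E)%E.
  apply: (@le_lt_trans _ _ (hausdorff_measure t E)); last by rewrite Ht lte_fin.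
  by apply: ereal_sup_ubound; exists 1 => //=.
move=> /ereal_inf_lt[_ [U [EU dU] <-] sU].
by exists U.
Qed.

(** Compactness turns a countable cover by arbitrary sets into finitely many balls, once the
    diameters are enlarged slightly so that open balls cover. Since the radii are at most 1 and t <
    p, their p-th powers are below their t-th powers. *)
Lemma hausdorff_dim_null_content E p : compact E ->
  (hausdorff_dim E < p%:R%:E)%E -> null_content p E.
Proof.
move=> cE /hausdorff_dim_cover[t [t0 tp hU]] e e0.
(* The bound 1/2 keeps the sum of the [r k] to the power t below 1, hence each radius at most 1; e /
   2 serves the final estimate. *)
pose e' := Num.min (1 / 2) (e / 2).
have e'0 : 0 < e' by rewrite lt_min !divr_gt0.
have [U [EU dU sU]] := hU _ e'0.
pose d k := fine (diam (U k)).
have dE k : diam (U k) = (d k)%:E.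
  rewrite fineK // ge0_fin_numE ?diam_ge0 //.
  by apply: (le_lt_trans (dU k)); rewrite ltry.
have d0 k : 0 <= d k by rewrite -lee_fin -dE diam_ge0.
(* The power t of [r k] exceeds that of [d k] by a term of a geometric series, so [r k] is positive
   even when the diameter is 0. *)
pose r k := (d k `^ t + e' * 2^-1 ^+ k.+1) `^ t^-1.
have pos k : 0 < d k `^ t + e' * 2^-1 ^+ k.+1.
  by rewrite ltr_wpDl ?powR_ge0 // mulr_gt0 // exprn_gt0 // invr_gt0.
have r0 k : 0 < r k by rewrite powR_gt0.
have rt k : r k `^ t = d k `^ t + e' * 2^-1 ^+ k.+1.
  by rewrite /r -powRrM mulVf ?powRr1 ?gt_eqF // ltW.
have dr k : d k < r k.
  rewrite ltNge; apply/negP => rd.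
  have := ge0_ler_powR (ltW t0) _ _ rd; rewrite !nnegrE => /(_ (ltW (r0 k)) (d0 k)).
  rewrite rt leNgt => /negP; apply; rewrite ltrDl.
  by rewrite mulr_gt0 // exprn_gt0 // invr_gt0.
have sumr N : \sum_(0 <= k < N) r k `^ t < 2 * e'.
  under eq_bigr do rewrite rt.
  rewrite big_split /= -mulr_sumr sum_pow_half.
  have : \sum_(0 <= k < N) d k `^ t < e'.
    rewrite -lte_fin -sumEFin; apply: le_lt_trans sU.
    under eq_bigr do rewrite -poweR_EFin -dE.
    by apply: nneseries_lim_ge => k _ _; exact: poweR_ge0.
  have : e' * (1 - 2^-1 ^+ N) <= e'.
    by rewrite ger_pMr // lerBlDr lerDl exprn_ge0 // invr_ge0.
  lra.
have r1 k : r k <= 1.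
  rewrite leNgt; apply/negP => r1.
  have : 1 <= r k `^ t by rewrite -(powRr0 (r k)); apply: ler_powR; exact: ltW.
  have := sumr k.+1; rewrite big_nat_recr //=.
  have : 0 <= \sum_(0 <= i < k) r i `^ t by apply: sumr_ge0 => i _; exact: powR_ge0.
  have : e' <= 1 / 2 by rewrite ge_min lexx.
  lra.
pose x k := xget (0 : 'rV[R]_m) (U k).
have covE : E `<=` cover setT (fun k => ball (x k) (r k)).
  move=> y /EU[k _ Uky]; exists k => //.
  have Ux : U k (x k) by apply: xgetPex; exists y.
  rewrite -ball_normE /= (le_lt_trans (norm_le_enorm _)) //.
  apply: le_lt_trans (dr k); rewrite -lee_fin -dE; exact: enorm_le_diam.
move: cE; rewrite compact_cover => cE.
have [|D _ covD] := cE _ _ _ _ covE.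
  by move=> k _; exact: ball_open.
(* The subcover is enlarged to an initial segment of indices, to match the partial sums in
   [sumr]. *)
have [N ltN] : exists N : nat, forall k, k \in finmap.enum_fset D -> (k < N)%N.
  exists (\max_(k <- finmap.enum_fset D) k).+1 => k kD; rewrite ltnS.
  exact: (@leq_bigmax_seq _ _ xpredT (fun k => k)).
exists [seq (x k, r k) | k <- iota 0 N]; split.
- move=> y /covD[k kD]; rewrite -ball_normE /= => yk.
  exists (x k, r k); last by rewrite /= distrC ltW.
  apply: (map_f (fun k => (x k, r k))).
  by rewrite mem_iota /= add0n ltN.
- by move=> _ /mapP[k _ ->]; exact: r0.
- rewrite big_map -/(index_iota 0 N).
  apply: (@lt_le_trans _ _ (2 * e')); last first.
    have : e' <= e / 2 by rewrite ge_min lexx orbT.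
    lra.
  apply: le_lt_trans (sumr N).
  rewrite -[N in iota 0 N]subn0 -/(index_iota 0 N).
  apply: ler_sum => k _.
  rewrite -powR_mulrn ?(ltW (r0 k)) //.
  have rk : 0 < r k <= 1 by rewrite r0 r1.
  exact: (ger_powR rk (ltW tp)).
Qed.

End HausdorffDim.

(** * Sections of radial projections *)

Section HausdorffSeparation.
Context (T : topologicalType).
Hypothesis hT : hausdorff_space T.

Lemma hausdorff_nbhs_disjoint (x y : T) : x <> y ->
  exists A B : set T, [/\ nbhs x A, nbhs y B & forall z, A z -> ~ B z].
Proof.
move=> xy; apply: contrapT => h; apply: xy; apply: hT => A B nA nB.
apply: contrapT => AB; apply: h; exists A, B; split => // z Az Bz.
by apply: AB; exists z.
Qed.

End HausdorffSeparation.

Lemma continuous_edot_sqr (R : realType) m :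
  continuous (fun x : 'rV[R]_m => edot x x).
Proof.
move=> x; apply: (@cvg_big _ _ _ _ _ _ _ (nbhs x)) => [|i _].
  exact: add_continuous.
by apply: (@cvgM _ _ (nbhs x)); exact: coord_continuous.
Qed.

Lemma continuous_enorm (R : realType) m : continuous (@enorm R m).
Proof.
move=> x; apply: (@continuous_comp _ _ _ (fun y : 'rV[R]_m => edot y y) Num.sqrt).
  exact: continuous_edot_sqr.
exact: sqrt_continuous.
Qed.

Lemma continuous_normalize (R : realType) m (x : 'rV[R]_m) : enorm x != 0 ->
  {for x, continuous (fun y : 'rV[R]_m => (enorm y)^-1 *: y)}.
Proof.
move=> x0; have F := @nbhs_filter _ x.
apply: (@cvgZ _ _ _ _ F); last exact: cvg_id.
by apply: (@cvgV _ _ _ F) => //; exact: continuous_enorm.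
Qed.

Section Segments.
Context (R : realType) (m : nat).
Implicit Types (x y z a : 'rV[R]_m) (s t : R).

Definition segpt z a t := (1 - t) *: z + t *: a.

Lemma segpt0 z a : segpt z a 0 = z.
Proof. by rewrite /segpt subr0 scale1r scale0r addr0. Qed.

Lemma segpt1 z a : segpt z a 1 = a.
Proof. by rewrite /segpt subrr scale1r scale0r add0r. Qed.

Lemma segptB z a s t : segpt z a s - segpt z a t = (s - t) *: (a - z).
Proof. by apply/rowP => i; rewrite !mxE; ring. Qed.

Lemma segpt_segpt z a s t : segpt z (segpt z a t) s = segpt z a (s * t).
Proof. by apply/rowP => i; rewrite !mxE; ring. Qed.

Lemma continuous_segpt z a : continuous (segpt z a).
Proof.
move=> t; rewrite /segpt.
apply: cvgD; apply: cvgZ; try exact: cvg_cst; last exact: cvg_id.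
by apply: cvgB; [exact: cvg_cst|exact: cvg_id].
Qed.

Lemma norm_segpt_lt x y t (d : R) : `|x| < d -> `|y| < d -> 0 <= t <= 1 ->
  `|segpt x y t| < d.
Proof.
move=> xd yd t01; apply: (le_lt_trans (ler_normD _ _)).
rewrite !normrZ !ger0_norm; [|lra|lra].
have [->|t0] := eqVneq t 0; first by rewrite subr0 mul1r mul0r addr0.
have : t * `|y| < t * d by rewrite ltr_pM2l //; lra.
have : (1 - t) * `|x| <= (1 - t) * d by apply: ler_wpM2l; [lra|exact: ltW].
lra.
Qed.

Definition convex_subset (W : set 'rV[R]_m) :=
  forall x y t, W x -> W y -> 0 <= t <= 1 -> W (segpt x y t).

Lemma ball_convex (y : 'rV[R]_m) (e : R) : convex_subset (ball y e).
Proof.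
move=> w1 w2 v; rewrite -!ball_normE /= => b1 b2 v01.
have -> : y - segpt w1 w2 v = segpt (y - w1) (y - w2) v.
  by apply/rowP => i; rewrite !mxE; ring.
exact: norm_segpt_lt.
Qed.

End Segments.

Section Lifts.
Context (R : realType) (m : nat) (M : topologicalType) (G : M -> 'rV[R]_m).
Hypothesis hausM : hausdorff_space M.
Hypothesis Gsphere : forall p, enorm (G p) = 1.
Hypothesis Gcont : continuous G.
Hypothesis Ginj : forall p : M, exists2 U : set M, nbhs p U &
  forall x x', U x -> U x' -> G x = G x' -> x = x'.

(** The set where the lifts agree is open by local injectivity of [G] and closed because [M] is
    Hausdorff. *)
Lemma lift_unique (T : topologicalType) (f f' : T -> M) (a : T) :
  connected [set: T] -> continuous f -> continuous f' ->
  (forall t, G (f t) = G (f' t)) -> f a = f' a -> forall t, f t = f' t.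
Proof.
move=> cT cf cf' Gff' fa.
have opn : open [set t | f t = f' t].
  rewrite openE => t /= ft; have [U nU injU] := Ginj (f t).
  have h1 : \forall x \near t, U (f x) by apply: cf.
  have h2 : \forall x \near t, U (f' x) by apply: cf'; rewrite -ft.
  by near=> x; apply: injU => //; near: x.
have cls : open (~` [set t | f t = f' t]).
  rewrite openE => t /= /(hausdorff_nbhs_disjoint hausM)[A [B [nA nB AB]]].
  have h1 : \forall x \near t, A (f x) by apply: cf.
  have h2 : \forall x \near t, B (f' x) by apply: cf'.
  near=> x => /= fx; apply: (AB (f x)); first by near: x.
  by rewrite fx; near: x.
have : [set t | f t = f' t] = setT.
  apply: cT; first by exists a.
    by exists [set t | f t = f' t] => //; rewrite setTI.
  exists [set t | f t = f' t]; last by rewrite setTI.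
  by rewrite -[X in closed X]setCK; apply: open_closedC.
by move=> h t; have : [set t | f t = f' t] t by rewrite h.
Unshelve. all: by end_near. Qed.

(** A section over [U] of the radial map (l, p) |-> l *: G p with l > 0. Using the ambient space
    instead of the sphere makes segments and convexity available. *)
Definition ray_section (U : set 'rV[R]_m) (s : 'rV[R]_m -> M) := forall y, U y ->
  {for y, continuous s} /\ exists2 l : R, 0 < l & y = l *: G (s y).

Lemma ray_sectionP U s y : ray_section U s -> U y ->
  G (s y) = (enorm y)^-1 *: y.
Proof.
move=> hs /hs[_ [l l0 e]].
have -> : enorm y = l.
  by rewrite e enormZ (Gsphere (s y)) mulr1 gtr0_norm.
by rewrite {2}e scalerA mulVf ?gt_eqF // scale1r.
Qed.

Lemma ray_section_sub U W s : W `<=` U -> ray_section U s -> ray_section W s.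
Proof. by move=> WU hs y /WU /hs. Qed.

(** Along the segment from [a] to [b] both sections lift the same radially projected path. *)
Lemma ray_section_unique W s s' a : convex_subset W ->
  ray_section W s -> ray_section W s' -> W a -> s a = s' a ->
  forall b, W b -> s b = s' b.
Proof.
move=> cW hs hs' Wa sa b Wb.
(* Clamping to [0, 1] extends the segment to a path on the whole line that stays in [W], so that
   [lift_unique] applies with domain [R]. *)
pose cl (t : R) : R := Num.max 0 (Num.min t 1).
have cl01 t : 0 <= cl t <= 1.
  rewrite /cl le_max lexx /= ge_max ler01 /=.
  by rewrite ge_min lexx orbT.
have ccl : continuous cl.
  move=> t; apply: (@continuous_max R R (cst 0) (id \min cst 1)).
    exact: cst_continuous.
  by apply: (@continuous_min R R id (cst 1)); [exact: cvg_id|exact: cst_continuous].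
pose g t := segpt a b (cl t).
have Wg t : W (g t) by apply: cW.
have cg : continuous g.
  by move=> t; apply: (continuous_comp (ccl t)); exact: continuous_segpt.
have := @lift_unique R (s \o g) (s' \o g) 0.
have cl0 : cl 0 = 0 by rewrite /cl min_l // maxxx.
have cl1 : cl 1 = 1 by rewrite /cl minxx max_r.
rewrite /= /g cl0 segpt0 => /(_ _ _ _ _ _ 1); rewrite cl1 segpt1; apply => //.
- by apply/connected_intervalP => x y _ _ z _.
- by move=> t; apply: (continuous_comp (cg t)); exact: (hs _ (Wg t)).1.
- by move=> t; apply: (continuous_comp (cg t)); exact: (hs' _ (Wg t)).1.
- by move=> t; rewrite (ray_sectionP hs (Wg t)) (ray_sectionP hs' (Wg t)).
Qed.

(** Thickening a segment gives an open and still convex set, so a section on it is determined by its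
    value at [z]. *)
Definition tube (z a : 'rV[R]_m) (d : R) : set 'rV[R]_m :=
  [set y | exists2 t : R, 0 <= t <= 1 & `|y - segpt z a t| < d].

Lemma tube_open z a d : open (tube z a d).
Proof.
rewrite openE => y [t t01 yt].
apply/nbhs_ballP; exists (d - `|y - segpt z a t|) => /=; first by rewrite subr_gt0.
move=> y'; rewrite -ball_normE /= => yy'; exists t => //.
have := ler_normD (y' - y) (y - segpt z a t); rewrite addrA subrK (distrC y' y).
move: yy'; rewrite ltrBrDr => h1 h2; exact: le_lt_trans h1.
Qed.

Lemma tube_convex z a d : convex_subset (tube z a d).
Proof.
move=> x y s [t t01 xt] [u u01 yu] s01.
exists ((1 - s) * t + s * u); first by apply/andP; split; nra.
have -> : segpt x y s - segpt z a ((1 - s) * t + s * u)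
   = (1 - s) *: (x - segpt z a t) + s *: (y - segpt z a u).
  apply/rowP => i; rewrite !mxE; ring.
exact: norm_segpt_lt.
Qed.

Lemma tube_shift z a a' d d' : `|a' - a| + d' <= d -> tube z a' d' `<=` tube z a d.
Proof.
move=> h y [t t01 yt]; exists t => //.
have -> : y - segpt z a t = y - segpt z a' t + t *: (a' - a).
  apply/rowP => i; rewrite !mxE; ring.
apply: (le_lt_trans (ler_normD _ _)); rewrite normrZ ger0_norm; last lra.
have : t * `|a' - a| <= `|a' - a| by apply: ler_piMl => //; lra.
lra.
Qed.

Lemma tube_prefix z a d t : 0 <= t <= 1 -> tube z (segpt z a t) d `<=` tube z a d.
Proof.
move=> t01 y [s s01]; rewrite segpt_segpt => h; exists (s * t) => //.
by apply/andP; split; nra.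
Qed.

End Lifts.

(** * Lifting segments *)

Lemma continuous_at_eq_near (T U : topologicalType) (f g : T -> U) (x : T)
    (A : set T) : nbhs x A -> (forall y, A y -> f y = g y) ->
  {for x, continuous g} -> {for x, continuous f}.
Proof.
move=> nA fg; rewrite /prop_for /continuous_at (fg x (nbhs_singleton nA)) => cg.
apply: cvg_trans cg; apply: near_eq_cvg.
by apply: filterS nA => y /fg ->.
Qed.

Lemma tube_start (R : realType) m (z a : 'rV[R]_m) (d : R) :
  0 < d -> tube z a d z.
Proof.
by move=> d0; exists 0; rewrite ?lexx ?ler01 // segpt0 subrr normr0.
Qed.

Lemma tube_end (R : realType) m (z a : 'rV[R]_m) (d : R) :
  0 < d -> tube z a d a.
Proof.
by move=> d0; exists 1; rewrite ?lexx ?ler01 // segpt1 subrr normr0.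
Qed.

Section SegmentLifting.
Context (R : realType) (m : nat) (M : topologicalType) (G : M -> 'rV[R]_m).
Context (E : set 'rV[R]_m) (p0 : M).
Hypothesis hausM : hausdorff_space M.
Hypothesis Gsphere : forall p, enorm (G p) = 1.
Hypothesis Gcont : continuous G.
Hypothesis Ginj : forall p : M, exists2 U : set M, nbhs p U &
  forall x x', U x -> U x' -> G x = G x' -> x = x'.
Hypothesis Gsec : forall p, exists2 e : R, 0 < e &
  exists2 t, t (G p) = p & ray_section G (ball (G p) e) t.
Hypothesis Gproper : forall y, enorm y = 1 -> ~ E y ->
  forall F : set_system M, ProperFilter F -> G x @[x --> F] --> y ->
  cluster F !=set0.
Hypothesis p0E : ~ E (G p0).

Let z := G p0.

Lemma ray_section_scaled p (l : R) : 0 < l -> exists2 e : R, 0 < e &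
  exists2 t, t (l *: G p) = p & ray_section G (ball (l *: G p) e) t.
Proof.
move=> l0; have [e e0 [t tp ht]] := Gsec p.
exists (l * e); first exact: mulr_gt0.
exists (fun y => t (l^-1 *: y)).
  by rewrite scalerA mulVf ?gt_eqF // scale1r.
move=> y; rewrite -ball_normE /= => yb.
have yb' : ball (G p) e (l^-1 *: y).
  rewrite -ball_normE /= -[G p](scalerK (lt0r_neq0 l0)) -scalerBr normrZ.
  by rewrite ger0_norm ?invr_ge0 ?(ltW l0) // ltr_pdivrMl.
have [ct [k k0 ky]] := ht _ yb'; split.
  have c1 : {for y, continuous (fun y : 'rV[R]_m => l^-1 *: y)}.
    exact: scaler_continuous.
  exact: continuous_comp c1 ct.
exists (l * k); first exact: mulr_gt0.
by rewrite -scalerA -ky scalerA divff ?gt_eqF // scale1r.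
Qed.

(** The lift lives on a neighbourhood of the segment, not on the segment alone: openness in [a] and
    passage to initial segments reduce to inclusions of tubes. *)
Definition liftable (a : 'rV[R]_m) := exists2 d : R, 0 < d &
  exists2 s : 'rV[R]_m -> M, s z = p0 & ray_section G (tube z a d) s.

Lemma liftable_base : liftable z.
Proof.
have [e e0 [t tz ht]] := Gsec p0; exists e => //; exists t => //.
apply: ray_section_sub ht => y [u _]; rewrite -ball_normE /= distrC.
suff -> : segpt z z u = z by [].
by rewrite /segpt -scalerDl subrK scale1r.
Qed.

Lemma liftable_prefix a t : 0 <= t <= 1 -> liftable a -> liftable (segpt z a t).
Proof.
move=> t01 [d d0 [s sz hs]]; exists d => //; exists s => //.
exact: ray_section_sub (tube_prefix t01) hs.
Qed.

Lemma liftable_open : open liftable.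
Proof.
rewrite openE => a [d d0 [s sz hs]].
apply/nbhs_ballP; exists (d / 2) => /=; first by rewrite divr_gt0.
move=> a'; rewrite -ball_normE /= => aa'.
exists (d / 2); first by rewrite divr_gt0.
exists s => //; apply: ray_section_sub hs; apply: tube_shift.
rewrite distrC; lra.
Qed.

(* The segment from [z] to [a] avoids the cone over [E], apex included. *)
Definition outside_shadow (a : 'rV[R]_m) := forall al r e,
  0 <= al -> 0 <= r -> E e \/ e = 0 -> a + al *: z <> r *: e.

(** A point of the segment on the cone would, after division by t, put [a] plus a nonnegative
    multiple of [z] on the cone. The parameter t = 0 is [z] itself, outside [E] by choice. *)
Lemma outside_shadow_segpt a t : outside_shadow a -> 0 <= t <= 1 ->
  let y := segpt z a t in y <> 0 /\ ~ E ((enorm y)^-1 *: y).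
Proof.
move=> Da /andP[t0 t1] y.
move: t0; rewrite le_eqVlt => /orP[/eqP t0|t0].
  rewrite /y -t0 segpt0 Gsphere invr1 scale1r; split => // z0.
  have := enormZ 0 z; rewrite scale0r -{1}z0 Gsphere normr0 mul0r.
  by move/eqP; rewrite oner_eq0.
have ay : a + ((1 - t) / t) *: z = t^-1 *: y.
  by apply/rowP => i; rewrite !mxE; field; rewrite gt_eqF.
have c0 : 0 <= (1 - t) / t by rewrite divr_ge0 ?(ltW t0) // subr_ge0.
have y0 : y <> 0.
  move=> y0; apply: (Da _ 0 0 c0 (lexx _)); first by right.
  by rewrite ay y0 !scaler0.
split => // Ey.
apply: (Da _ (t^-1 * enorm y) _ c0) (or_introl Ey) _.
  by rewrite mulr_ge0 ?invr_ge0 ?(ltW t0) // enorm_ge0.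
by rewrite ay scalerA -mulrA divff ?mulr1 // gt_eqF // enorm_gt0.
Qed.

(** By properness the lifted end points [q t] cluster at some [x] as t tends to T from the left, and
    [G x] is the direction of the point [y] at time T. A local section through [x] meets the lift at
    an earlier time u, by local injectivity, and the two are glued. *)
Lemma liftable_step a T : outside_shadow a -> 0 <= T <= 1 ->
  (forall t, 0 <= t < T -> liftable (segpt z a t)) ->
  exists2 h : R, 0 < h & forall t, 0 <= t <= 1 -> t < T + h ->
    liftable (segpt z a t).
Proof.
move=> Da T01 hT.
(* For T = 0 there are no earlier times to take a limit of; openness around [z] suffices. *)
move: (T01) => /andP[]; rewrite le_eqVlt => /orP[/eqP T0 _|T0 T1].
  have : \forall t \near (0 : R), liftable (segpt z a t).
    apply: continuous_segpt; rewrite segpt0.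
    exact: open_nbhs_nbhs (conj liftable_open liftable_base).
  move=> /nbhs_ballP[h /= h0 hh]; exists h => // t /andP[t0 _].
  rewrite -T0 add0r => th; apply: hh.
  by rewrite -ball_normE /= sub0r normrN ger0_norm.
have [y0 nEy] := outside_shadow_segpt Da T01.
set y := segpt z a T in y0 nEy *.
have ny0 : 0 < enorm y by exact: enorm_gt0.
have [q hq] : {q : R -> M & forall t, 0 <= t < T ->
    exists2 d : R, 0 < d & exists2 s : 'rV[R]_m -> M, s z = p0 &
      ray_section G (tube z (segpt z a t) d) s /\ q t = s (segpt z a t)}.
  apply: (@choice R M (fun t x => 0 <= t < T -> exists2 d : R, 0 < d &
    exists2 s : 'rV[R]_m -> M, s z = p0 &
      ray_section G (tube z (segpt z a t) d) s /\ x = s (segpt z a t))) => t.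
  have [tT|nt] := pselect (0 <= t < T); last by exists p0.
  have [d d0 [s sz hs]] := hT _ tT.
  by exists (s (segpt z a t)) => _; exists d => //; exists s.
have nearT : \forall t \near T^'-, 0 <= t < T.
  near=> t; apply/andP; split; last by near: t; exact: nbhs_left_lt.
  by near: t; exact: nbhs_left_ge.
have cvGq : G x @[x --> q t @[t --> T^'-]] --> (enorm y)^-1 *: y.
  have : (enorm (segpt z a t))^-1 *: segpt z a t @[t --> T^'-] --> (enorm y)^-1 *: y.
    have ny1 : enorm (segpt z a T) != 0 by rewrite gt_eqF.
    apply: cvg_at_left_filter.
    exact: (continuous_comp (@continuous_segpt _ _ z a T) (continuous_normalize ny1)).
  move=> cvy; apply: cvg_trans cvy.
  apply: (@near_eq_cvg _ _ (T^'-) _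
    (fun t => (enorm (segpt z a t))^-1 *: segpt z a t) (G \o q)).
  near=> t => /=.
  have /hq[d d0 [s sz [hs ->]]] : 0 <= t < T by near: t.
  rewrite (ray_sectionP Gsphere hs) //.
  exact: tube_end.
have [|x clx] := Gproper _ nEy _ cvGq.
  by rewrite enormZ ger0_norm ?invr_ge0 ?enorm_ge0 // mulVf ?gt_eqF.
(* [q] need not converge, but the image of its cluster point is forced by the convergence of [G]
   along [q]. *)
have Gx : G x = (enorm y)^-1 *: y.
  apply: (@norm_hausdorff R 'rV[R]_m) => A B nA nB.
  have [w [Bw Aw]] := clx _ _ (cvGq _ nB) (Gcont nA).
  by exists (G w).
have yE : y = enorm y *: G x by rewrite Gx scalerA divff ?gt_eqF // scale1r.
have [e e0 [t0 tx ht0]] := ray_section_scaled x ny0.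
rewrite -yE in tx ht0.
have [U nU injU] := Ginj x.
have [e' e'0 [e'e e'U]] : exists2 e' : R, 0 < e' & e' <= e /\
    forall w, ball y e' w -> U (t0 w).
  have : \forall w \near y, U (t0 w).
    by apply: (ht0 y (ballxx _ e0)).1; rewrite tx.
  move=> /nbhs_ballP[e1 /= e10 he1].
  exists (Num.min e e1); first by rewrite lt_min e0.
  split; first by rewrite ge_min lexx.
  by move=> w yw; apply: he1; apply: le_ball yw; rewrite ge_min lexx orbT.
(* [L] bounds the speed of the segment, the added 1 keeping it nonzero; a time change below [h] then
   moves the point by less than e' / 2. *)
pose L := `|a - z| + 1.
have L0 : 0 < L by rewrite ltr_wpDl.
pose h := e' / (2 * L).
have h0 : 0 < h by rewrite divr_gt0 // mulr_gt0.
have closeT t : `|t - T| < h -> `|segpt z a t - y| < e' / 2.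
  move=> tT; rewrite segptB normrZ.
  have : `|t - T| * `|a - z| <= `|t - T| * L by apply: ler_wpM2l => //; rewrite lerDl.
  have : `|t - T| * L < h * L by rewrite ltr_pM2r.
  have -> : h * L = e' / 2 by rewrite /h; field; rewrite gt_eqF.
  by move=> h1 h2; apply: le_lt_trans h1.
(* Clustering gives times u as close to T as desired with [q u] in the injectivity neighbourhood of
   [x]. *)
have [u [u0 uT uh Uq]] : exists u, [/\ 0 <= u, u < T, T - h < u & U (q u)].
  have : (q t @[t --> T^'-]) [set w | exists u, [/\ 0 <= u, u < T, T - h < u & w = q u]].
    rewrite /=; near=> t; have /andP[tge tlt] : 0 <= t < T by near: t.
    exists t; split => //; near: t.
    by apply: nbhs_left_gt; rewrite ltrBlDr ltrDl.
  by move=> /clx /(_ nU) [w [[u [? ? ? ->]] Uw]]; exists u.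
have uT' : 0 <= u < T by rewrite u0.
have [d d0 [s sz [hs qs]]] := hq _ uT'.
pose g := segpt z a u.
have hgy : `|g - y| < e' / 2 by apply: closeT; rewrite ltr0_norm ?opprB; lra.
have gtube : tube z g d g by exact: tube_end.
have gball : ball y e' g by rewrite -ball_normE /= distrC; lra.
have ht0' : ray_section G (ball y e') t0 by apply: ray_section_sub ht0; exact: le_ball.
have sg : s g = t0 g.
  apply: injU; [by rewrite -qs|exact: e'U|].
  by rewrite (ray_sectionP Gsphere hs gtube) (ray_sectionP Gsphere ht0' gball).
have agree w : tube z g d w -> ball y e' w -> s w = t0 w.
  move=> w1 w2.
  apply: (@ray_section_unique _ _ _ _ hausM Gsphere Ginj (tube z g d `&` ball y e') s t0 g) => //.
  - move=> w3 w4 v [? ?] [? ?] v01.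
    by split; [exact: tube_convex|exact: ball_convex].
  - by apply: ray_section_sub hs => ? [].
  - by apply: ray_section_sub ht0' => ? [].
(* The sections agree on the convex overlap of tube and ball, so the glued map is locally one of the
   two. *)
pose s' w := if pselect (tube z g d w) then s w else t0 w.
have s'1 w : tube z g d w -> s' w = s w by rewrite /s'; case: pselect.
have s'2 w : ball y e' w -> s' w = t0 w.
  by rewrite /s'; case: pselect => // w1 w2; exact: agree.
have hs'1 : ray_section G (tube z g d) s'.
  move=> w w1; have [cs [l l0 wl]] := hs _ w1; split; last first.
    by exists l => //; rewrite s'1.
  apply: continuous_at_eq_near s'1 cs.
  by apply: open_nbhs_nbhs; split => //; exact: tube_open.
have hs'2 : ray_section G (ball y e') s'.
  move=> w w1; have [cs [l l0 wl]] := ht0' _ w1; split; last first.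
    by exists l => //; rewrite s'2.
  apply: continuous_at_eq_near s'2 cs.
  by apply: open_nbhs_nbhs; split => //; exact: ball_open.
exists h => // t1 t101 t1T.
exists (Num.min d (e' / 2)); first by rewrite lt_min d0 divr_gt0.
exists s'; first by rewrite s'1 //; exact: tube_start.
have dd : Num.min d (e' / 2) <= d by rewrite ge_min lexx.
have de : Num.min d (e' / 2) <= e' / 2 by rewrite ge_min lexx orbT.
move=> w [v v01]; rewrite segpt_segpt => wv.
(* Up to parameter u the new tube lies in the old one, beyond u in the ball about [y]. *)
have [vu|uv] := leP (v * t1) u.
  apply: hs'1.
  have [u00|u00] := eqVneq u 0.
    exists 0; first by rewrite lexx ler01.
    rewrite segpt0; move: wv; have -> : v * t1 = 0.
      by apply/eqP; rewrite eq_le; apply/andP; split; nra.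
    by rewrite segpt0 => ?; lra.
  exists (v * t1 / u).
    rewrite divr_ge0 //=; last nra.
    by rewrite ler_pdivrMr ?mul1r // lt_def u00.
  by rewrite segpt_segpt mulfVK //; lra.
apply: hs'2; rewrite -ball_normE /= distrC.
have -> : w - y = (w - segpt z a (v * t1)) + (segpt z a (v * t1) - y) by rewrite addrA subrK.
apply: (le_lt_trans (ler_normD _ _)).
have : `|segpt z a (v * t1) - y| < e' / 2.
  apply: closeT; rewrite ltr_norml; apply/andP; split; first lra.
  have : v * t1 <= t1 by apply: ler_piMl; lra.
  lra.
lra.
Unshelve. all: by end_near. Qed.

(** Continuation: if the supremum of the liftable parameters were below 1, [liftable_step] would
    pass beyond it; if it is 1, the step reaches [a] itself. *)
Lemma liftable_outside_shadow a : outside_shadow a -> liftable a.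
Proof.
move=> Da.
pose S := [set t : R | 0 <= t <= 1 /\ liftable (segpt z a t)].
have S0 : S 0.
  split; first by rewrite lexx ler01.
  by rewrite segpt0; exact: liftable_base.
have supS : has_sup S by split; [exists 0|exists 1 => t [/andP[]]].
have T01 : 0 <= sup S <= 1.
  by rewrite sup_upper_bound //= ge_sup //; [exists 0|move=> t [/andP[]]].
have [t|h h0 hh] := liftable_step Da T01.
  move=> /andP[t0 tT]; have tT' : 0 < sup S - t by rewrite subr_gt0.
  have [t' [/andP[t'0 t'1] lt']] := sup_adherent tT' supS.
  rewrite subKr => tt'.
  have t'p : 0 < t' by apply: le_lt_trans tt'.
  have -> : segpt z a t = segpt z (segpt z a t') (t / t').
    by rewrite segpt_segpt mulfVK // gt_eqF.
  apply: liftable_prefix => //.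
  by rewrite divr_ge0 //= ler_pdivrMr // mul1r ltW.
move: T01 => /andP[T0 T1].
have [T1'|T1'] := ltP (sup S) 1; last first.
  by rewrite -(segpt1 z a); apply: hh; lra.
pose t := Num.min 1 (sup S + h / 2).
have tt : sup S < t by rewrite lt_min T1' ltrDl divr_gt0.
have tle : t <= sup S + h / 2 by rewrite ge_min lexx orbT.
have t1 : t <= 1 by rewrite ge_min lexx.
have : S t.
  have t01 : 0 <= t <= 1 by lra.
  by split => //; apply: hh => //; lra.
by move=> /(sup_upper_bound supS); rewrite leNgt tt.
Qed.

(** The value at [a] is that of a section on some tube around [z, a]. For [b] near [a], a thinner
    tube around [z, b] lies in the tube of [a], and uniqueness starting from [z] identifies the two
    values at [b]. *)
Lemma lift_section : exists s, ray_section G liftable s /\ s z = p0.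
Proof.
have [s hs] : {s : 'rV[R]_m -> M & forall a, liftable a ->
    exists2 d : R, 0 < d & exists2 s' : 'rV[R]_m -> M, s' z = p0 &
      ray_section G (tube z a d) s' /\ s a = s' a}.
  apply: (@choice _ M (fun a x => liftable a -> exists2 d : R, 0 < d &
    exists2 s' : 'rV[R]_m -> M, s' z = p0 &
      ray_section G (tube z a d) s' /\ x = s' a)) => a.
  have [la|nl] := pselect (liftable a); last by exists p0.
  have [d d0 [s' sz hs]] := la.
  by exists (s' a) => _; exists d => //; exists s'.
exists s; split; last first.
  have [d d0 [s' s'z [_ ->]]] := hs _ liftable_base; exact: s'z.
move=> a la; have [d d0 [s' s'z [hs' sa]]] := hs _ la.
have eqs b : ball a d b -> s b = s' b.
  rewrite -ball_normE /= => ab.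
  have hb : tube z b (d - `|b - a|) `<=` tube z a d.
    by apply: tube_shift; rewrite addrC subrK.
  have lb : liftable b.
    exists (d - `|b - a|); first by rewrite subr_gt0 distrC.
    by exists s' => //; exact: ray_section_sub hs'.
  have [d1 d10 [s1 s1z [hs1 ->]]] := hs _ lb.
  have tt c : tube z b (Num.min d1 (d - `|b - a|)) c -> tube z b d1 c /\ tube z a d c.
    move=> [t t01]; rewrite lt_min => /andP[c1 c2].
    by split; [|apply: hb]; exists t.
  have dp : 0 < Num.min d1 (d - `|b - a|) by rewrite lt_min d10 subr_gt0 distrC.
  apply: (@ray_section_unique _ _ _ _ hausM Gsphere Ginj
      (tube z b (Num.min d1 (d - `|b - a|))) s1 s' z).
  - exact: tube_convex.
  - by apply: ray_section_sub hs1 => c /tt[].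
  - by apply: ray_section_sub hs' => c /tt[].
  - exact: tube_start.
  - by rewrite s1z.
  - exact: tube_end.
have ta : tube z a d a by exact: tube_end.
have [ca [l l0 al]] := hs' _ ta; split; last by exists l; rewrite ?sa.
by apply: continuous_at_eq_near eqs ca; exact: nbhsx_ballx.
Qed.

End SegmentLifting.

(** * Injectivity in the presence of a small exceptional set *)

Lemma null_content_set0 (R : realType) m p : (0 < p)%N ->
  null_content p [set 0 : 'rV[R]_m].
Proof.
move=> p0 e e0; pose r := Num.min 1 (e / 2).
have r0 : 0 < r by rewrite lt_min ltr01 divr_gt0.
exists [:: (0, r)]; split.
- by move=> _ ->; exists (0, r); rewrite ?inE //= subrr normr0 ltW.
- by move=> q; rewrite inE => /eqP ->.
- rewrite big_seq1 /=; apply: (@le_lt_trans _ _ r).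
    by case: p p0 => // p _; rewrite exprS ger_pMr // exprn_ile1 ?ge_min ?lexx // ltW.
  have : r <= e / 2 by rewrite ge_min lexx orbT.
  lra.
Qed.

(** Designed to contain the [c] for which the segment from [a] to [c] is blocked; the bound [N]
    keeps it within reach of finite covers. *)
Definition bounded_span (R : realType) m (E : set 'rV[R]_m) (z a : 'rV[R]_m)
    (N : R) : set 'rV[R]_m :=
  [set y | exists r al be e, [/\ `|r| <= N, `|al| <= N, `|be| <= N, E e &
     y = r *: e + al *: z + be *: a]].

(** Three one-parameter sweeps, a scaling and translations along [z] and [a], each adding one to the
    exponent. *)
Lemma null_content_bounded_span (R : realType) m p (E : set 'rV[R]_m) z a N :
  (0 < p)%N -> 0 <= N -> (forall e, E e -> `|e| <= 1) ->
  null_content p E -> null_content p.+3 (bounded_span E z a N).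
Proof.
move=> p0 N0 E1 nE.
have lip b r r' (x x' : 'rV[R]_m) :
    `|(x + r *: b) - (x' + r' *: b)| <= (1 + `|b|) * (`|r - r'| + `|x - x'|).
  have -> : (x + r *: b) - (x' + r' *: b) = (x - x') + (r - r') *: b.
    by apply/rowP => i; rewrite !mxE; ring.
  apply: (le_trans (ler_normD _ _)); rewrite normrZ.
  have := normr_ge0 b; have := normr_ge0 (x - x'); have := normr_ge0 (r - r').
  nra.
have pos b : 0 < 1 + `|b : 'rV[R]_m| by rewrite ltr_wpDr.
have N20 : 0 < N + 2 by lra.
have h1 : null_content p.+1 [set y | exists r x, [/\ `|r| <= N, E x & y = r *: x]].
  (* [N] bounds the scalar, and 2 bounds x', which lies within 1 of a point of norm at most 1. *)
  apply: (@null_content_family R m p E (fun r x => r *: x) N (N + 2)) => //.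
  move=> r r' x x' rN Ex xx'.
  have -> : r *: x - r' *: x' = r *: (x - x') + (r - r') *: x'.
    by apply/rowP => i; rewrite !mxE; ring.
  apply: (le_trans (ler_normD _ _)); rewrite !normrZ.
  have x'2 : `|x'| <= 2.
    have -> : x' = x - (x - x') by rewrite opprB addrC subrK.
    apply: (le_trans (ler_normB _ _)); have := E1 _ Ex; lra.
  have : `|r - r'| * `|x'| <= `|r - r'| * 2 by apply: ler_wpM2l.
  have : `|r| * `|x - x'| <= N * `|x - x'| by apply: ler_wpM2r.
  have := normr_ge0 (x - x'); have := normr_ge0 (r - r').
  nra.
have h2 := @null_content_family R m p.+1 _ (fun r x => x + r *: z) N _
  isT N0 (pos z) (fun r r' x x' _ _ _ => lip z r r' x x') h1.
have h3 := @null_content_family R m p.+2 _ (fun r x => x + r *: a) N _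
  isT N0 (pos a) (fun r r' x x' _ _ _ => lip a r r' x x') h2.
move=> e e0; have [l [c1 c2 c3]] := h3 e e0; exists l; split => // y.
move=> [r [al [be [x [rN alN beN Ex ->]]]]]; apply: c1.
exists be, (r *: x + al *: z); split => //.
exists al, (r *: x); split => //.
by exists r, x.
Qed.

Section Injectivity.
Context (R : realType) (p : nat) (M : topologicalType).
Context (G : M -> 'rV[R]_p.+3) (E : set 'rV[R]_p.+3).
Hypothesis p_gt0 : (0 < p)%N.
Hypothesis hausM : hausdorff_space M.
Hypothesis connM : connected [set: M].
Hypothesis Gsphere : forall x, enorm (G x) = 1.
Hypothesis Gcont : continuous G.
Hypothesis Ginj : forall x : M, exists2 U : set M, nbhs x U &
  forall y y', U y -> U y' -> G y = G y' -> y = y'.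
Hypothesis Gsec : forall x, exists2 e : R, 0 < e &
  exists2 t, t (G x) = x & ray_section G (ball (G x) e) t.
Hypothesis Gproper : forall y, enorm y = 1 -> ~ E y ->
  forall F : set_system M, ProperFilter F -> G x @[x --> F] --> y ->
  cluster F !=set0.
Hypothesis Esphere : forall e, E e -> enorm e = 1.
Hypothesis Eclosed : closed E.
Hypothesis Enull : null_content p E.

Let V := 'rV[R]_p.+3.
Let E0 : set V := E `|` [set 0].

Lemma null_content_cone z a N : 0 <= N -> null_content p.+3 (bounded_span E0 z a N).
Proof.
move=> N0; apply: null_content_bounded_span => //.
  move=> e [/Esphere e1|->]; last by rewrite normr0.
  by rewrite -e1 norm_le_enorm.
by apply: null_contentU => //; exact: null_content_set0.
Qed.

(** The rays through values of [G] fill a neighbourhood of [G x], whereas the cone over [E] contains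
    no ball. *)
Lemma exists_regular_value (x : M) : exists x', ~ E (G x').
Proof.
have [e e0 [t tx ht]] := Gsec x.
(* This constant bounds the Euclidean norm of all points of the sup-norm ball, hence the scalar
   [l]. *)
have N0 : 0 <= enorm (G x) + p.+3%:R * (1 + e) + 1.
  by rewrite addr_ge0 ?addr_ge0 ?mulr_ge0 ?enorm_ge0 // addr_ge0 // ltW.
have [c [cG nc]] := null_content_avoid (G x) (null_content_cone 0 0 N0) e0.
have cb : ball (G x) e c by rewrite -ball_normE /= distrC.
exists (t c) => Etc; apply: nc.
have [_ [l l0 cl]] := ht _ cb.
exists l, 0, 0, (G (t c)); split; rewrite ?normr0 //.
- rewrite gtr0_norm //.
  have lc : l = enorm c by rewrite cl enormZ Gsphere mulr1 gtr0_norm.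
  have c2 : l ^+ 2 <= p.+3%:R * (1 + e) ^+ 2.
    rewrite lc sqr_enorm; apply: le_trans (edot_le c) _.
    rewrite ler_wpM2l // lerXn2r ?nnegrE //; first by lra.
    have -> : c = (c - G x) + G x by rewrite subrK.
    apply: (le_trans (ler_normD _ _)).
    by have := norm_le_enorm (G x); rewrite Gsphere; lra.
  have p1 : 1 <= p.+3%:R :> R by rewrite ler1n.
  rewrite Gsphere; rewrite -(@ler_pXn2r R 2) ?nnegrE //; [|exact: ltW|].
    apply: (le_trans c2); have : 0 <= e by exact: ltW.
    move: p1; set q : R := p.+3%:R; nra.
  by move: N0; rewrite Gsphere.
- by left.
- by rewrite !scaler0 !addr0.
Qed.

(** * Shadow and liftable points for a fixed base point *)

Section Basepoint.
Context (p0 : M).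
Hypothesis p0E : ~ E (G p0).
Let z := G p0.

Local Notation good := (@liftable R p.+3 M G p0).
Local Notation unshaded := (@outside_shadow R p.+3 M G E p0).

Lemma cone_avoids_base : exists2 d : R, 0 < d &
  forall y r e, ball z d y -> 0 <= r -> E0 e -> y <> r *: e.
Proof.
have z0 : enorm (z : V) != 0 by rewrite Gsphere oner_neq0.
have cproj := continuous_normalize z0.
have h1 : \forall y \near z, ~ E ((enorm y)^-1 *: y).
  apply: (cproj (~` E)); apply: open_nbhs_nbhs; split; first exact: closed_openC.
  by rewrite /= /z Gsphere invr1 scale1r.
have h2 : \forall y \near z, enorm y != 0.
  by apply: (@cvgr_neq0 _ _ _ (nbhs (z : V)) _ _ _ _ z0); exact: continuous_enorm.
have /nbhs_ballP[d /= d0 hd] : \forall y \near z, enorm y != 0 /\ ~ E ((enorm y)^-1 *: y).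
  by near=> y; split; near: y.
exists d => // y r e /hd[ny nEy] r0 E0e yre.
have enz : enorm (0 : V) = 0 by rewrite -(scale0r (0 : V)) enormZ normr0 mul0r.
case: E0e => [Ee|e0]; last first.
  by move: ny; rewrite yre e0 scaler0 enz eqxx.
have ny' : enorm y = r by rewrite yre enormZ (Esphere Ee) mulr1 ger0_norm.
apply: nEy; rewrite ny' yre scalerA mulVf ?scale1r //.
by rewrite -ny'.
Unshelve. all: by end_near. Qed.

(** Dividing y + al z = r e by al puts z + y / al on the cone, which avoids the ball of radius [d]
    about [z]; hence al <= rho / d. Then r is bounded because [e] is a unit vector. *)
Lemma shadow_bounded (rho : R) : 0 <= rho -> exists2 N, 0 <= N & forall y, `|y| <= rho ->
  ~ unshaded y -> exists al r e, [/\ 0 <= al, al <= N, 0 <= r, r <= N &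
    E0 e /\ y = r *: e - al *: z].
Proof.
move=> rho0; have [d d0 hd] := cone_avoids_base.
have z1 : `|z| <= 1 by have := norm_le_enorm z; rewrite Gsphere.
pose A := rho / d.
have A0 : 0 <= A by rewrite divr_ge0 // ltW.
(* The factor [p.+3] comes from comparing norms: a Euclidean unit vector [e] satisfies 1 <= p.+3 |e|
   for the sup norm. *)
pose N := A + p.+3%:R * (rho + A).
have N1 : 0 <= p.+3%:R * (rho + A) by rewrite mulr_ge0 // addr_ge0.
exists N; first by rewrite addr_ge0.
move=> y yrho nD.
have [al [r [e [al0 r0 Ee ye]]]] : exists al r e,
    [/\ 0 <= al, 0 <= r, E0 e & y + al *: z = r *: e].
  apply: contrapT => h; apply: nD => al r e al0 r0 Ee ye.
  by apply: h; exists al, r, e.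
have alA : al <= A.
  move: al0; rewrite le_eqVlt => /orP[/eqP <- //|al0].
  rewrite leNgt; apply/negP => Aal.
  apply: (hd (z + al^-1 *: y) (r / al) e) => //.
  - rewrite -ball_normE /= opprD addrA subrr add0r normrN normrZ.
    rewrite gtr0_norm ?invr_gt0 // mulrC ltr_pdivrMr // mulrC.
    by rewrite -ltr_pdivrMr //; apply: le_lt_trans Aal; rewrite ler_pM2r ?invr_gt0.
  - by rewrite divr_ge0 // ltW.
  - by rewrite mulrC -scalerA -ye scalerDr scalerA mulVf ?gt_eqF // scale1r addrC.
(* At the apex the scalar is arbitrary, so it is reset to 0. *)
exists al, (if pselect (e = 0) then 0 else r), e; split => //.
- by apply: (le_trans alA); rewrite lerDl.
- by case: pselect.
- case: pselect => // e0 /=; first by rewrite addr_ge0.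
  have e1 : enorm e = 1 by case: Ee => // /Esphere.
  have en1 : `|e| <= 1 by rewrite -e1 norm_le_enorm.
  have : 1 <= p.+3%:R * `|e|.
    have := edot_le e; rewrite -sqr_enorm e1 expr1n => h; apply: (le_trans h).
    by apply: ler_wpM2l => //; rewrite expr2; apply: ler_piMr.
  have : r * `|e| <= rho + A.
    rewrite -(ger0_norm r0) -normrZ -ye; apply: (le_trans (ler_normD _ _)).
    rewrite normrZ ger0_norm //.
    have : al * `|z| <= al by apply: ler_piMr.
    lra.
  have := ler0n R p.+3; rewrite /N; set q : R := p.+3%:R => q0 re qe.
  have : q * (r * `|e|) <= q * (rho + A) by apply: ler_wpM2l.
  have : r <= r * (q * `|e|) by rewrite ler_peMr.
  nra.
- split => //; have -> : y = r *: e - al *: z by rewrite -ye addrK.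
  by case: pselect => //= e0; rewrite [in LHS]e0 [in RHS]e0 !scaler0.
Qed.

Lemma good_open : open good.
Proof. exact: liftable_open. Qed.

Lemma good_unshaded a : unshaded a -> good a.
Proof. exact: liftable_outside_shadow. Qed.

Lemma convex_comb_le (x y t r : R) : 0 <= t -> t <= 1 -> x <= r -> y <= r ->
  (1 - t) * x + t * y <= r.
Proof. nra. Qed.

(** If the point at parameter t between [w] and [c] is shaded, solving for [c] puts it in the span
    of [E0], [z] and [w] with coefficients divided by t. The end points are only known to be
    liftable, not unshaded, so small t is settled by openness, which also bounds 1 / t. *)
Lemma avoid_shadow a b (c0 : V) (h : R) : 0 < h -> good a -> good b ->
  exists c, [/\ `|c - c0| < h, unshaded c,
    forall t, 0 <= t <= 1 -> good (segpt a c t) &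
    forall t, 0 <= t <= 1 -> good (segpt b c t)].
Proof.
move=> h0 ga gb.
have [rho [rho0 arho brho crho]] : exists rho : R, [/\ 0 < rho, `|a| <= rho,
    `|b| <= rho & `|c0| + h <= rho].
  exists (`|a| + `|b| + (`|c0| + h)).
  have := normr_ge0 a; have := normr_ge0 b; have := normr_ge0 c0.
  by split; lra.
have [N N0 hN] := shadow_bounded (ltW rho0).
have [d [d0 da db]] : exists d : R, [/\ 0 < d, forall y, `|y - a| < d -> good y &
    forall y, `|y - b| < d -> good y].
  have /nbhs_ballP[d1 /= d10 h1] : nbhs a good.
    exact: open_nbhs_nbhs (conj good_open ga).
  have /nbhs_ballP[d2 /= d20 h2] : nbhs b good.
    exact: open_nbhs_nbhs (conj good_open gb).
  exists (Num.min d1 d2); split; first by rewrite lt_min d10.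
    move=> y ya; apply: h1; rewrite -ball_normE /= distrC; apply: (lt_le_trans ya).
    by rewrite ge_min lexx.
  move=> y ya; apply: h2; rewrite -ball_normE /= distrC; apply: (lt_le_trans ya).
  by rewrite ge_min lexx orbT.
(* 2 rho / d bounds 1 / t and [N] bounds al and r; the added ones let a single constant dominate [N]
   and (1 - t) / t as well. *)
pose N' := (N + 1) * (2 * rho / d + 1).
have k0 : 0 <= 2 * rho / d by rewrite divr_ge0 ?(ltW d0) // mulr_ge0 // ltW.
have NN' : N <= N' by rewrite /N'; nra.
have N'0 : 0 <= N' by exact: le_trans NN'.
have scaled_coef_le1 x y : 0 <= x -> x <= 2 * rho / d -> 0 <= y -> y <= 1 -> x * y <= N'.
  by move=> x0 xk y0 y1; have := ler_pM x0 y0 xk y1; rewrite /N'; nra.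
have scaled_coef_le x y : 0 <= x -> x <= 2 * rho / d -> 0 <= y -> y <= N -> x * y <= N'.
  by move=> x0 xk y0 yN; have := ler_pM x0 y0 xk yN; rewrite /N'; nra.
have [c [cc0 nc]] := null_content_avoid c0
  (null_contentU (null_content_cone z a N'0) (null_content_cone z b N'0)) h0.
have crho' : `|c| <= rho.
  have -> : c = (c - c0) + c0 by rewrite subrK.
  by apply: (le_trans (ler_normD _ _)); lra.
have seg w : `|w| <= rho -> (forall y, `|y - w| < d -> good y) ->
    ~ bounded_span E0 z w N' c -> forall t, 0 <= t <= 1 -> good (segpt w c t).
  move=> wrho hw ncw t t01; apply: contrapT => ng.
  have td : d <= t * (2 * rho).
    rewrite leNgt; apply/negP => td; apply: ng; apply: hw.
    have -> : segpt w c t - w = t *: (c - w).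
      by apply/rowP => i; rewrite !mxE; ring.
    rewrite normrZ ger0_norm; last lra.
    apply: le_lt_trans td; apply: ler_wpM2l; first lra.
    by apply: (le_trans (ler_normB _ _)); lra.
  have t0 : 0 < t.
    rewrite lt_neqAle; apply/andP; split; last lra.
    by apply/eqP => t0; move: td; rewrite -t0 mul0r; lra.
  have ti : t^-1 <= 2 * rho / d.
    by rewrite ler_pdivlMr // mulrC ler_pdivrMr // mulrC.
  have ti0 : 0 <= t^-1 by rewrite invr_ge0 ltW.
  have {t01} /andP[t00 t1] := t01.
  have segrho : `|segpt w c t| <= rho.
    apply: (le_trans (ler_normD _ _)); rewrite !normrZ (ger0_norm t00) ger0_norm ?subr_ge0 //.
    exact: convex_comb_le.
  have [|al [r [e [al0 alN r0 rN [Ee ye]]]]] := hN (segpt w c t) segrho.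
    by move=> /good_unshaded.
  apply: ncw; exists (t^-1 * r), (- (t^-1 * al)), (- (t^-1 * (1 - t))), e.
  have cE : c = (t^-1 * r) *: e + (- (t^-1 * al)) *: z + (- (t^-1 * (1 - t))) *: w.
    rewrite -!scalerA !scaleNr -!scalerA.
    have -> : r *: e = segpt w c t + al *: z by rewrite ye subrK.
    by apply/rowP => i; rewrite !mxE; field; rewrite gt_eqF.
  have s0 : 0 <= 1 - t by rewrite subr_ge0.
  have s1 : 1 - t <= 1 by rewrite gerBl.
  split; [| | |exact: Ee|exact: cE].
  - rewrite ger0_norm ?mulr_ge0 //; exact: scaled_coef_le.
  - rewrite normrN ger0_norm ?mulr_ge0 //; exact: scaled_coef_le.
  - rewrite normrN ger0_norm ?mulr_ge0 //; exact: scaled_coef_le1.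
exists c; split.
- exact: cc0.
- apply: contrapT => nD; apply: nc; left.
  have [al [r [e [al0 alN r0 rN [Ee ye]]]]] := hN c crho' nD.
  exists r, (- al), 0, e; split; [| | |exact: Ee|].
  - by rewrite ger0_norm //; exact: le_trans NN'.
  - by rewrite normrN ger0_norm //; exact: le_trans NN'.
  - by rewrite normr0.
  - by rewrite scale0r addr0 scaleNr.
- by apply: seg => // nca; apply: nc; left.
- by apply: seg => // nca; apply: nc; right.
Qed.

Lemma unshaded_scale (l : R) c : 0 < l -> unshaded c -> unshaded (l *: c).
Proof.
move=> l0 uc al r e al0 r0 Ee h.
apply: (uc (al / l) (r / l) e); rewrite ?divr_ge0 ?(ltW l0) //.
have -> : (r / l) *: e = l^-1 *: (r *: e) by rewrite scalerA mulrC.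
rewrite -h scalerDr !scalerA mulVf ?gt_eqF // scale1r.
by rewrite [al / l]mulrC.
Qed.


(** Instead of deleting the bad preimage, [A1] and [A2] sort all points of [M] by whether the good
    points nearby are recovered by [s] or are not. Broken segments show that one alternative holds
    near each point, density that not both do. Connectedness of [M] itself then applies. *)
Lemma injective_on_good : exists s : V -> M, forall x, good (G x) -> s (G x) = x.
Proof.
have [s [hs sz]] : exists s, ray_section G good s /\ s z = p0 by exact: lift_section.
have goodz : good z by exact: liftable_base.
have openX : open (G @^-1` good).
  by apply: open_comp => [x _|]; [exact: Gcont|exact: good_open].
pose X1 := [set x | good (G x) /\ s (G x) = x].
pose A1 := [set x : M | nbhs x [set y | good (G y) -> X1 y]].
pose A2 := [set x : M | nbhs x [set y | good (G y) -> ~ X1 y]].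
have proj1 x : (enorm (G x))^-1 *: G x = G x by rewrite Gsphere invr1 scale1r.
(* Shrinking makes the local section [t] a left inverse of [G] near [x]. *)
have local x : exists2 e : R, 0 < e & exists2 W, nbhs x W &
    exists2 t, ray_section G (ball (G x) e) t &
      forall w, W w -> ball (G x) e (G w) /\ t (G w) = w.
  have [e e0 [t tx ht]] := Gsec x; have [U nU injU] := Ginj x.
  have : \forall y \near G x, U (t y).
    by apply: (ht _ (ballxx _ e0)).1; rewrite tx.
  move=> /nbhs_ballP[e1 /= e10 he1].
  pose e2 := Num.min e e1; have e20 : 0 < e2 by rewrite lt_min e0.
  have e2e : e2 <= e by rewrite ge_min lexx.
  have e2e1 : e2 <= e1 by rewrite ge_min lexx orbT.
  have ht2 : ray_section G (ball (G x) e2) t by apply: ray_section_sub ht; exact: le_ball.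
  exists e2 => //; exists (U `&` G @^-1` ball (G x) e2).
    by apply: filterI => //; apply: Gcont; exact: nbhsx_ballx.
  exists t => // w [Uw bw]; split => //; apply: injU => //.
    by apply: he1; apply: le_ball bw.
  by rewrite (ray_sectionP Gsphere ht2) // proj1.
(* Along a segment inside both the local ball and the domain of [s], the
   sections [s] and [t] agree at one end iff they agree at the other. *)
have transfer (x : M) e t a c : ray_section G (ball (G x) e) t ->
    ball (G x) e a -> ball (G x) e c ->
    (forall v, 0 <= v <= 1 -> good (segpt a c v)) -> (s a = t a <-> s c = t c).
  move=> ht ba bc gac.
  pose W := [set w | exists2 v : R, 0 <= v <= 1 & w = segpt a c v].
  have cW : convex_subset W.
    move=> _ _ v [v1 v101 ->] [v2 v201 ->] v01.
    exists ((1 - v) * v1 + v * v2); first by apply/andP; split; nra.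
    by apply/rowP => i; rewrite !mxE; ring.
  have sW : ray_section G W s.
    by apply: ray_section_sub hs => _ [v v01 ->]; exact: gac.
  have tW : ray_section G W t.
    by apply: ray_section_sub ht => _ [v v01 ->]; exact: ball_convex.
  have Wa : W a by exists 0; rewrite ?lexx ?ler01 ?segpt0.
  have Wc : W c by exists 1; rewrite ?lexx ?ler01 ?segpt1.
  split => h.
    exact: (ray_section_unique hausM Gsphere Ginj cW sW tW Wa h Wc).
  exact: (ray_section_unique hausM Gsphere Ginj cW sW tW Wc h Wa).
have A12 x : A1 x \/ A2 x.
  have [e e0 [W nW [t ht hW]]] := local x.
  (* The comparison of [s] with [t] is carried from [w] to [w'] along the broken segment through
     [c]. *)
  have same w w' : W w -> W w' -> good (G w) -> good (G w') -> X1 w -> X1 w'.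
    move=> /hW[bw tw] /hW[bw' tw'] gw gw' [_ sw]; split => //.
    have [c [cx uc segw segw']] := avoid_shadow (G x) e0 gw gw'.
    have bc : ball (G x) e c by rewrite -ball_normE /= distrC.
    have h1 := transfer x e t _ c ht bw bc segw.
    have h2 := transfer x e t _ c ht bw' bc segw'.
    by rewrite -[RHS]tw'; apply/h2/h1; rewrite sw tw.
  have [[w [Ww gw Xw]]|nw] := pselect (exists w, [/\ W w, good (G w) & X1 w]).
    by left; apply: filterS nW => w' Ww' gw'; exact: (same w w').
  by right; apply: filterS nW => w' Ww' gw' Xw'; apply: nw; exists w'.
(* An unshaded [c] close to [G x] yields a point [t c] near [x] with good direction, which cannot
   satisfy both alternatives. *)
have A12disj x : A1 x -> A2 x -> False.
  rewrite /A1 /A2 /= => h1 h2.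
  have [e e0 [t tx ht]] := Gsec x.
  have : \forall y \near G x, [set y | good (G y) -> X1 y] (t y) /\
      [set y | good (G y) -> ~ X1 y] (t y).
    have ct := (ht _ (ballxx _ e0)).1; rewrite -tx in h1 h2.
    by near=> y; split; near: y; apply: ct.
  move=> /nbhs_ballP[e1 /= e10 he1].
  have e20 : 0 < Num.min e e1 by rewrite lt_min e0.
  have [c [cx uc _ _]] := avoid_shadow (G x) e20 goodz goodz.
  have bc : ball (G x) (Num.min e e1) c by rewrite -ball_normE /= distrC.
  have [|k1 k2] := he1 c; first by apply: le_ball bc; rewrite ge_min lexx orbT.
  have gc : good (G (t c)).
    rewrite (ray_sectionP Gsphere ht); last by apply: le_ball bc; rewrite ge_min lexx.
    apply: good_unshaded; apply: unshaded_scale => //.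
    rewrite invr_gt0; apply: enorm_gt0 => c0.
    by apply: (uc 0 0 0); rewrite ?scale0r ?addr0 //; right.
  exact: (k2 gc (k1 gc)).
have oA1 : open A1.
  by rewrite openE => x /= nx; exact: nbhs_interior.
have oA2 : open A2.
  by rewrite openE => x /= nx; exact: nbhs_interior.
have A1T : A1 = setT.
  apply: connM.
  - exists p0; case: (A12 p0) => // /nbhs_singleton /(_ goodz) nX.
    by exfalso; apply: nX.
  - by exists A1 => //; rewrite setTI.
  - exists A1; last by rewrite setTI.
    have -> : A1 = ~` A2.
      apply/seteqP; split => x /=; first by move=> a1 a2; exact: (A12disj x).
      by case: (A12 x).
    exact: open_closedC.
exists s => x gx.
have : A1 x by rewrite A1T.
by move=> /nbhs_singleton /(_ gx)[].
Unshelve. all: by end_near. Qed.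

End Basepoint.

(** Distinct preimages have disjoint neighbourhoods and local sections over a common ball; above an
    unshaded direction both values are recovered by the same [s], so they coincide. *)
Theorem injective_of_small_exceptional_set : injective G.
Proof.
move=> x x' Gxx'; apply: contrapT => /(hausdorff_nbhs_disjoint hausM)[A [B [nA nB AB]]].
have [p0 p0E] := exists_regular_value x.
have [s hs] := injective_on_good p0E.
have [e e0 [t tx ht]] := Gsec x.
have [e' e'0 [t' tx' ht']] := Gsec x'.
have : \forall y \near G x, A (t y).
  by apply: (ht _ (ballxx _ e0)).1; rewrite tx.
move=> /nbhs_ballP[e1 /= e10 he1].
have : \forall y \near G x', B (t' y).
  by apply: (ht' _ (ballxx _ e'0)).1; rewrite tx'.
move=> /nbhs_ballP[e2 /= e20 he2].
pose d := Num.min (Num.min e e') (Num.min e1 e2).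
have d0 : 0 < d by rewrite !lt_min e0 e'0 e10.
have goodz : liftable G p0 (G p0) by exact: liftable_base.
have [c [cx uc _ _]] := avoid_shadow p0E (G x) d0 goodz goodz.
have bc : ball (G x) d c by rewrite -ball_normE /= distrC.
have be : ball (G x) e c by apply: le_ball bc; rewrite !ge_min lexx.
have be' : ball (G x') e' c by rewrite -Gxx'; apply: le_ball bc; rewrite !ge_min lexx !orbT.
have b1 : ball (G x) e1 c by apply: le_ball bc; rewrite !ge_min lexx !orbT.
have b2 : ball (G x') e2 c by rewrite -Gxx'; apply: le_ball bc; rewrite !ge_min lexx !orbT.
have gc : liftable G p0 ((enorm c)^-1 *: c).
  apply: good_unshaded => //; apply: unshaded_scale => //.
  rewrite invr_gt0; apply: enorm_gt0 => c0.
  by apply: (uc 0 0 0); rewrite ?scale0r ?addr0 //; right.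
have E1 := ray_sectionP Gsphere ht be.
have E2 := ray_sectionP Gsphere ht' be'.
apply: (AB (t c)); first exact: he1.
have <- : t' c = t c; last exact: he2.
rewrite -(hs (t c)) ?E1 // -[LHS](hs (t' c)) ?E2 //.
Qed.

End Injectivity.

(** * Simultaneous diagonalization of two symmetric forms *)

Section SimultaneousDiagonalization.
Context (R : realType) (n : nat).
Let V := 'rV[R]_n.

Definition symmetric_bilinear (g : V -> V -> R) :=
  (forall a u v w, g (a *: u + v) w = a * g u w + g v w) /\
  (forall u v, g u v = g v u).

Section Form.
Context (g : V -> V -> R) (hg : symmetric_bilinear g).

Lemma sbil0l w : g 0 w = 0.
Proof.
have := hg.1 (-1) 0 0 w; rewrite scaler0 addr0; lra.
Qed.

Lemma sbilDl u v w : g (u + v) w = g u w + g v w.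
Proof. by have := hg.1 1 u v w; rewrite scale1r mul1r. Qed.

Lemma sbilZl a u w : g (a *: u) w = a * g u w.
Proof. by rewrite -(addr0 (a *: u)) hg.1 sbil0l addr0. Qed.

Lemma sbilDr u v w : g w (u + v) = g w u + g w v.
Proof. by rewrite hg.2 sbilDl !(hg.2 _ w). Qed.

Lemma sbilZr a u w : g w (a *: u) = a * g w u.
Proof. by rewrite hg.2 sbilZl hg.2. Qed.

Lemma sbil_suml I (r : seq I) (P : pred I) (F : I -> V) w :
  g (\sum_(i <- r | P i) F i) w = \sum_(i <- r | P i) g (F i) w.
Proof.
by apply: (big_morph (fun u => g u w)) => [u v|]; [exact: sbilDl|exact: sbil0l].
Qed.

Lemma sbil_sumr I (r : seq I) (P : pred I) (F : I -> V) w :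
  g w (\sum_(i <- r | P i) F i) = \sum_(i <- r | P i) g w (F i).
Proof. by rewrite hg.2 sbil_suml; apply: eq_bigr => i _; rewrite hg.2. Qed.

Lemma sbilEl u w : g u w = \sum_i u 0 i * g (delta_mx 0 i) w.
Proof.
rewrite {1}(row_sum_delta u) sbil_suml.
by apply: eq_bigr => i _; rewrite sbilZl.
Qed.

Lemma continuous_sbil_r u : continuous (g u).
Proof.
have -> : g u = fun w => \sum_i w 0 i * g u (delta_mx 0 i).
  by apply/funext => w; rewrite hg.2 sbilEl; apply: eq_bigr => i _; rewrite hg.2.
move=> w; have F := @nbhs_filter _ w.
apply: (@cvg_big _ _ _ _ _ _ _ _ _ _ _ F) => [|i _]; first exact: add_continuous.
by apply: (@cvgM _ _ _ F); [exact: coord_continuous|exact: cvg_cst].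
Qed.

Lemma continuous_sbil_sqr : continuous (fun u => g u u).
Proof.
have -> : (fun u => g u u) = fun u => \sum_i u 0 i * g (delta_mx 0 i) u.
  by apply/funext => w; rewrite sbilEl.
move=> w; have F := @nbhs_filter _ w.
apply: (@cvg_big _ _ _ _ _ _ _ _ _ _ _ F) => [|i _]; first exact: add_continuous.
by apply: (@cvgM _ _ _ F); [exact: coord_continuous|exact: continuous_sbil_r].
Qed.

End Form.

Context (g h : V -> V -> R).
Hypotheses (hg : symmetric_bilinear g) (hh : symmetric_bilinear h).
Hypothesis gpos : forall v, v != 0 -> 0 < g v v.

(** The eigenvector equation is tested against every [v], so vectors [g]-orthogonal to those found
    so far are also [h]-orthogonal to them. *)
Definition partial_eigenbasis k (e : nat -> V) (lam : nat -> R) :=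
  forall i, (i < k)%N ->
    (forall j, (j < k)%N -> g (e i) (e j) = (i == j)%:R) /\
    (forall v, h (e i) v = lam i * g (e i) v).

Lemma orthogonal_nonzero k (e : nat -> V) : (k < n)%N ->
  exists2 v : V, v != 0 & forall i, (i < k)%N -> g (e i) v = 0.
Proof.
move=> kn.
pose A : 'M[R]_(n, k) := \matrix_(j, i) g (e i) (delta_mx 0 j).
have : kermx A != 0.
  rewrite kermx_eq0 /row_free; apply/eqP => rA.
  by have := rank_leq_col A; rewrite rA leqNgt kn.
rewrite -nz_row_eq0 => v0.
exists (nz_row (kermx A)) => // i ik.
have /sub_kermxP vA := nz_row_sub (kermx A).
have := congr1 (fun B : 'rV[R]_k => B 0 (Ordinal ik)) vA.
rewrite !mxE => vi.
rewrite -[RHS]vi hg.2 sbilEl //; apply: eq_bigr => j _.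
by rewrite [in RHS]mxE /= hg.2.
Qed.

(** The next vector maximises h v v / g v v on the [g]-complement [W]; the quotient is invariant
    under scaling, so the compact sup-norm sphere of [W] will do. The first variation gives the
    eigenvector equation on [W], and projection along the earlier vectors extends it to all [v]. *)
Lemma rayleigh_step k e lam : (k < n)%N -> partial_eigenbasis k e lam ->
  exists e' lam', partial_eigenbasis k.+1 e' lam'.
Proof.
move=> kn he.
pose W := [set v : V | forall i, (i < k)%N -> g (e i) v = 0].
have WZ a v : W v -> W (a *: v).
  by move=> Wv i ik; rewrite sbilZr // Wv // mulr0.
pose K := [set v : V | `|v| = 1] `&`
  \bigcap_(i in [set i | (i < k)%N]) [set v | g (e i) v = 0].
have K0 : K !=set0.
  have [v v0 hv] := orthogonal_nonzero e kn.
  exists (`|v|^-1 *: v); split => /=; last by move=> i ik; apply: WZ ik.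
  by rewrite normrZ ger0_norm ?invr_ge0 // mulVf ?normr_eq0.
have cK : compact K.
  apply: bounded_closed_compact.
    by exists 1; split => // x x1 v [v1 _]; rewrite /= [`|v|]v1 ltW.
  apply: closedI.
    apply: (@preimage_closed _ _ (fun v : V => `|v|) [set 1]); last exact: closed_eq.
    by move=> v _; exact: norm_continuous.
  apply: closed_bigI => i _.
  apply: (@preimage_closed _ _ (g (e i)) [set 0]); last exact: closed_eq.
  by move=> v _; exact: continuous_sbil_r.
have Kn0 v : K v -> v != 0.
  by move=> [v1 _]; rewrite -normr_eq0 v1 oner_neq0.
pose f v := h v v / g v v.
have [|c cK' cmax] := EVT_max_rV (f := f) K0 cK.
  apply: continuous_in_subspaceT => v; rewrite inE => Kv.
  have F := @nbhs_filter _ v.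
  apply: (@cvgM _ _ _ F); first exact: continuous_sbil_sqr.
  apply: (@cvgV _ _ _ F); last exact: continuous_sbil_sqr.
  by rewrite gt_eqF // gpos // Kn0.
rewrite inE in cK'.
have c0 := Kn0 _ cK'; have gc := gpos c0.
have Wc : W c by case: cK'.
set mu := f c in cmax.
have hc : h c c = mu * g c c by rewrite /mu /f mulfVK // gt_eqF.
have hle w : W w -> h w w <= mu * g w w.
  move=> Ww; have [->|w0] := eqVneq w 0; first by rewrite !sbil0l // mulr0.
  have gw := gpos w0; rewrite -ler_pdivrMr //.
  have nw : `|w| != 0 by rewrite normr_eq0.
  have Kw : K (`|w|^-1 *: w).
    split => /=; last by move=> i ik; apply: WZ ik.
    by rewrite normrZ ger0_norm ?invr_ge0 // mulVf.
  have := cmax (`|w|^-1 *: w); rewrite inE => /(_ Kw).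
  rewrite /f !sbilZl // !sbilZr // invfM => le1.
  apply: le_trans le1; rewrite le_eqVlt; apply/orP; left; apply/eqP.
  by field; rewrite nw /=; exact: lt0r_neq0.
have hcw w : W w -> h c w = mu * g c w.
  move=> Ww; pose b := h c w - mu * g c w; pose q := h w w - mu * g w w.
  have q0 : q <= 0 by rewrite subr_le0 hle.
  have key s : 2 * s * b + s ^+ 2 * q <= 0.
    have : W (c + s *: w) by move=> i ik; rewrite sbilDr // sbilZr // Wc // Ww // mulr0 addr0.
    move=> /hle; rewrite !sbilDl // !sbilDr // !sbilZl // !sbilZr //.
    rewrite (hh.2 w c) (hg.2 w c) hc /b /q; lra.
  (* This value turns the expression into b^2 (2 - q) / (1 - q)^2, which is nonpositive only for b =
     0. *)
  have := key (b / (1 - q)).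
  have q1 : 0 < 1 - q by lra.
  have -> : 2 * (b / (1 - q)) * b + (b / (1 - q)) ^+ 2 * q
     = b ^+ 2 * ((2 - q) / (1 - q) ^+ 2) by field; rewrite gt_eqF.
  rewrite pmulr_lle0; last by rewrite divr_gt0 ?exprn_gt0 //; lra.
  move=> b2; have : b = 0 by apply/eqP; rewrite -sqrf_eq0 eq_le b2 sqr_ge0.
  by rewrite /b => /eqP; rewrite subr_eq0 => /eqP.
have hcv v : h c v = mu * g c v.
  pose u := \sum_(i < k) g (e i) v *: e i.
  have Wvu : W (v - u).
    move=> i ik; rewrite sbilDr // -scaleN1r sbilZr // sbil_sumr //.
    rewrite (bigD1 (Ordinal ik)) //= big1.
      by rewrite sbilZr // ((he _ ik).1 _ ik) eqxx mulr1 addr0 mulN1r subrr.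
    move=> j ji; rewrite sbilZr // ((he _ ik).1 _ (ltn_ord j)).
    rewrite (_ : (i == j) = false) ?mulr0 //; apply/negbTE.
    by apply: contra ji => /eqP ij; apply/eqP; exact: val_inj.
  have gcu : g c u = 0.
    rewrite sbil_sumr // big1 // => i _.
    by rewrite sbilZr // (hg.2 c) (Wc _ (ltn_ord i)) mulr0.
  have hcu : h c u = 0.
    rewrite sbil_sumr // big1 // => i _.
    by rewrite sbilZr // (hh.2 c) ((he _ (ltn_ord i)).2) (Wc _ (ltn_ord i)) !mulr0.
  have -> : v = (v - u) + u by rewrite subrK.
  by rewrite (sbilDr hh (v - u)) (sbilDr hg (v - u)) gcu hcu !addr0 hcw.
pose r := (Num.sqrt (g c c))^-1.
have rr : r * r * g c c = 1.
  by rewrite -[r * r]expr2 exprVn sqr_sqrtr ?(ltW gc) // mulVf ?gt_eqF.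
exists (fun i => if (i < k)%N then e i else r *: c).
exists (fun i => if (i < k)%N then lam i else mu).
move=> i; rewrite ltnS leq_eqVlt => /orP[/eqP ->|ik].
  rewrite ltnn; split => [j|v]; last by rewrite !sbilZl // hcv; ring.
  rewrite ltnS leq_eqVlt => /orP[/eqP ->|jk].
    by rewrite ltnn eqxx sbilZl // sbilZr // mulrA.
  by rewrite jk sbilZl // hg.2 (Wc _ jk) mulr0 gtn_eqF.
rewrite ik; split => [j|v]; last by rewrite (he _ ik).2.
rewrite ltnS leq_eqVlt => /orP[/eqP ->|jk]; last by rewrite jk (he _ ik).1.
by rewrite ltnn sbilZr // (Wc _ ik) mulr0 ltn_eqF.
Qed.

Lemma exists_eigenbasis : exists (e : 'I_n -> V) (lam : 'I_n -> R),
  (forall i j, g (e i) (e j) = (i == j)%:R) /\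
  (forall i v, h (e i) v = lam i * g (e i) v).
Proof.
have : forall k, (k <= n)%N -> exists e lam, partial_eigenbasis k e lam.
  elim=> [_|k IH kn]; first by exists (fun=> 0), (fun=> 0).
  have [e [lam he]] := IH (ltnW kn).
  exact: rayleigh_step kn he.
move=> /(_ n (leqnn n))[e [lam he]].
exists (fun i => e i), (fun i => lam i); split => i.
  by move=> j; rewrite (he _ (ltn_ord i)).1.
by move=> v; rewrite (he _ (ltn_ord i)).2.
Qed.

End SimultaneousDiagonalization.

(** * Mixed derivatives and strict differentiability *)

Section Lines.
Context (R : realType) (V W : normedModType R).

Lemma is_derive_line (f : V -> W) (a v : V) (t : R) : derivable f (a + t *: v) v ->
  is_derive t 1 (fun s : R => f (a + s *: v)) ('D_v f (a + t *: v)).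
Proof.
have E : (fun h : R => h^-1 *: (((fun s : R => f (a + s *: v)) \o shift t) (h *: 1) - f (a + t *: v)))
   = (fun h : R => h^-1 *: ((f \o shift (a + t *: v)) (h *: v) - f (a + t *: v))).
  apply/funext => h /=; congr (_ *: (f _ - _)).
  by rewrite /shift /= -[h *: 1]/(h * 1) mulr1 scalerDl addrCA.
move=> df; have df' : derivable (fun s : R => f (a + s *: v)) t 1.
  by rewrite /derivable E.
by apply: DeriveDef => //; rewrite /derive E.
Qed.

Lemma is_derive_translate (f : V -> W) (c x v : V) : derivable f (x + c) v ->
  is_derive x v (fun y => f (y + c)) ('D_v f (x + c)).
Proof.
have E : (fun h : R => h^-1 *: (((fun y => f (y + c)) \o shift x) (h *: v) - f (x + c)))
   = (fun h : R => h^-1 *: ((f \o shift (x + c)) (h *: v) - f (x + c))).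
  by apply/funext => h /=; rewrite addrA.
move=> df; have df' : derivable (fun y => f (y + c)) x v by rewrite /derivable E.
by apply: DeriveDef => //; rewrite /derive E.
Qed.

Lemma differentiable_eps (f : V -> W) (x : V) : differentiable f x ->
  forall e : R, 0 < e -> exists2 d : R, 0 < d & forall h, `|h| < d ->
    `|f (x + h) - f x - 'd f x h| <= e * `|h|.
Proof.
move=> /diff_locally /eqaddoP df e e0.
have /nbhs_ballP[d /= d0 hd] := df e e0.
exists d => // h hl; have := hd h; rewrite -ball_normE /= sub0r normrN => /(_ hl).
by rewrite !fctE /= opprD addrA [h + x]addrC.
Qed.

End Lines.

Section Coordinates.
Context (R : realType) (V : normedModType R) (m : nat).

Lemma derivable_coord (F : V -> 'rV[R]_m) x v i :
  derivable F x v -> derivable (fun y => F y 0 i) x v.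
Proof. by move/derivable_mxP. Qed.

Lemma derive_coord (F : V -> 'rV[R]_m) x v i : derivable F x v ->
  'D_v (fun y => F y 0 i) x = 'D_v F x 0 i.
Proof. by move=> dF; rewrite derive_mx // mxE. Qed.

End Coordinates.

Section Schwarz.
Context (R : realType) (V : normedModType R).

Lemma mean_value_segment (f : V -> R) (a v : V) (h : R) : 0 < h ->
  (forall t, 0 <= t <= h -> derivable f (a + t *: v) v) ->
  exists2 t, 0 <= t <= h & f (a + h *: v) - f a = 'D_v f (a + t *: v) * h.
Proof.
move=> h0 df.
have [t th|t th|c ch] := @MVT R (fun s => f (a + s *: v)) (fun t => 'D_v f (a + t *: v)) 0 h h0.
- by apply: is_derive_line; apply: df; move: th; rewrite in_itv /=; lra.
- apply: derivable_within_continuous t th => s; rewrite in_itv /= => sh.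
  exact: (@ex_derive _ _ _ _ _ _ _ (is_derive_line (df _ sh))).
rewrite scale0r addr0 subr0 => E; exists c => //.
by move: ch; rewrite in_itv /=; lra.
Qed.

(* A second difference is computed by applying the mean value theorem in the
   direction [v] only; the Frechet derivative of ['D_v f] at [x] does the rest. *)
Lemma second_difference (f g : V -> R) (x v w : V) :
  (\forall y \near x, derivable f y v /\ 'D_v f y = g y) ->
  differentiable g x ->
  forall e : R, 0 < e -> exists2 d : R, 0 < d & forall h, 0 < h -> h < d ->
    `|(f (x + h *: v + h *: w) - f (x + h *: v)) - (f (x + h *: w) - f x)
      - 'D_w g x * h ^+ 2| <= e * h ^+ 2.
Proof.
move=> /nbhs_ballP[r /= r0 hr] dDf e e0.
pose k := `|v| + `|w| + 1.
have v0 := normr_ge0 v; have w0 := normr_ge0 w.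
have k0 : 0 < k by rewrite /k; lra.
(* Two remainders occur, each at most e1 h k = e h / 2. *)
pose e1 := e / (2 * k).
have e10 : 0 < e1 by rewrite divr_gt0 // mulr_gt0.
have [d1 d10 hd1] := differentiable_eps dDf e10.
pose d := Num.min r d1 / k.
have d0 : 0 < d by rewrite divr_gt0 // lt_min r0.
exists d => // h h0 hd.
have hk : h * k < Num.min r d1 by rewrite -ltr_pdivlMr.
have small t s : 0 <= t <= h -> 0 <= s <= h -> `|t *: v + s *: w| <= h * k.
  move=> /andP[t0 th] /andP[s0 sh]; apply: (le_trans (ler_normD _ _)).
  rewrite !normrZ !ger0_norm // /k; nra.
have h0h : 0 <= h <= h by rewrite ltW /=.
have zh : 0 <= (0 : R) <= h by rewrite lexx ltW.
have dv' t s : 0 <= t <= h -> 0 <= s <= h ->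
    derivable f (x + (t *: v + s *: w)) v /\
    'D_v f (x + (t *: v + s *: w)) = g (x + (t *: v + s *: w)).
  move=> th sh; apply: hr; rewrite -ball_normE /= opprD addrA subrr add0r normrN.
  apply: (le_lt_trans (small _ _ th sh)); apply: (lt_le_trans hk).
  by rewrite ge_min lexx.
have dv t s (th : 0 <= t <= h) (sh : 0 <= s <= h) := (dv' t s th sh).1.
have [|t th ->] := @mean_value_segment (fun y => f (y + h *: w) - f y) x v h h0.
  move=> t th; apply: derivableB.
    apply: (@ex_derive _ _ _ _ _ _ _ (is_derive_translate _)).
    by rewrite -addrA; exact: dv.
  by have := dv t 0 th zh; rewrite scale0r addr0.
have -> : 'D_v (fun y => f (y + h *: w) - f y) (x + t *: v)
    = g (x + t *: v + h *: w) - g (x + t *: v).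
  have d2 : derivable f (x + t *: v + h *: w) v by rewrite -addrA; exact: dv.
  have d3 : derivable f (x + t *: v) v.
    by have := dv t 0 th zh; rewrite scale0r addr0.
  have := is_derive_translate d2 => d2'.
  rewrite deriveB; [|exact: (@ex_derive _ _ _ _ _ _ _ d2')|exact: d3].
  congr (_ - _).
    by rewrite (@derive_val _ _ _ _ _ _ _ d2') -addrA; exact: (dv' t h th h0h).2.
  by have := (dv' t 0 th zh).2; rewrite scale0r addr0.
rewrite (deriveE w dDf) expr2 !mulrA -mulrBl normrM (gtr0_norm h0).
rewrite ler_pM2r //.
have h1 := hd1 (t *: v + h *: w).
have h2 := hd1 (t *: v + 0 *: w).
have lt1 s : 0 <= s <= h -> `|t *: v + s *: w| < d1.
  move=> sh; apply: (le_lt_trans (small _ _ th sh)); apply: (lt_le_trans hk).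
  by rewrite ge_min lexx orbT.
move: h1 h2 => /(_ (lt1 _ h0h)) h1 /(_ (lt1 _ zh)).
rewrite scale0r addr0 => h2.
have s1 := small _ _ th h0h; have := small _ _ th zh; rewrite scale0r addr0 => s2.
have E1 : 'd g x (t *: v) = t * 'd g x v by rewrite linearZ.
have E2 : 'd g x (h *: w) = h * 'd g x w by rewrite linearZ.
move: h1 h2; rewrite linearD E1 E2 /= addrA; set A := g _; set B := g _.
set C := g _; set L := 'd _ _ v; set L' := 'd _ _ w => h1 h2.
have -> : A - C - L' * h = (A - B - (t * L + h * L')) - (C - B - t * L).
  ring.
apply: (le_trans (ler_normB _ _)).
have : e1 * `|t *: v + h *: w| <= e1 * (h * k) by rewrite ler_pM2l.
have : e1 * `|t *: v| <= e1 * (h * k) by rewrite ler_pM2l.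
have -> : e1 * (h * k) = e * h / 2 by rewrite /e1; field; rewrite gt_eqF.
lra.
Qed.

(** The second difference is symmetric in [v] and [w]; divided by h^2 it is close to both mixed
    derivatives. *)
Lemma derive_comm (f g g' : V -> R) (x v w : V) :
  (\forall y \near x, derivable f y v /\ 'D_v f y = g y) ->
  (\forall y \near x, derivable f y w /\ 'D_w f y = g' y) ->
  differentiable g x -> differentiable g' x -> 'D_w g x = 'D_v g' x.
Proof.
move=> df df' dv dw; apply/eqP; rewrite -subr_eq0 -normr_le0.
apply/ler_addgt0Pr => e e0; rewrite add0r.
have e20 : 0 < e / 2 by rewrite divr_gt0.
have [d1 d10 h1] := second_difference w df dv e20.
have [d2 d20 h2] := second_difference v df' dw e20.
pose h := Num.min d1 d2 / 2.
have m0 : 0 < Num.min d1 d2 by rewrite lt_min d10.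
have h0 : 0 < h by rewrite divr_gt0.
have hd : h < Num.min d1 d2 by rewrite /h; lra.
move: hd; rewrite lt_min => /andP[hd1 hd2].
have := h1 h h0 hd1; have := h2 h h0 hd2.
rewrite (addrAC x (h *: w)).
move: (f (x + h *: v + h *: w)) (f (x + h *: v)) (f (x + h *: w)) (f x) => a b c f0.
move: ('D_w g x) ('D_v g' x) => P Q k1 k2.
have hh : 0 < h ^+ 2 by rewrite exprn_gt0.
rewrite -(ler_pM2r hh) -{1}(gtr0_norm hh) -normrM mulrBl.
have -> : P * h ^+ 2 - Q * h ^+ 2 = (a - c - (b - f0) - Q * h ^+ 2) - (a - b - (c - f0) - P * h ^+ 2) by ring.
apply: (le_trans (ler_normB _ _)); lra.
Qed.

End Schwarz.

Section StrictDifferentiability.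
Context (R : realType) (n m : nat).

Lemma diff_row_sum (F : 'rV[R]_n -> 'rV[R]_m) x u : differentiable F x ->
  'd F x u = \sum_j u 0 j *: 'D_(delta_mx 0 j) F x.
Proof.
move=> dF; rewrite {1}(row_sum_delta u) linear_sum.
by apply: eq_bigr => j _; rewrite linearZ /= deriveE.
Qed.

Lemma diff_coord (F : 'rV[R]_n -> 'rV[R]_m) x u i : differentiable F x ->
  'd F x u 0 i = \sum_j u 0 j * 'D_(delta_mx 0 j) F x 0 i.
Proof.
move=> /diff_row_sum ->; rewrite summxE; apply: eq_bigr => j _.
by rewrite mxE.
Qed.

(** In each coordinate the mean value theorem turns the increment into a derivative at some point of
    the segment, and continuity of the partial derivatives brings it back to [x0]. *)
Lemma strict_differentiability (F : 'rV[R]_n -> 'rV[R]_m) (x0 : 'rV[R]_n) :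
  (\forall y \near x0, differentiable F y) ->
  (forall j, {for x0, continuous ('D_(delta_mx 0 j) F)}) ->
  forall e : R, 0 < e -> exists2 d : R, 0 < d & forall x y,
    `|x - x0| < d -> `|y - x0| < d ->
    `|F x - F y - 'd F x0 (x - y)| <= e * `|x - y|.
Proof.
move=> dF cF e e0.
pose e1 := e / n.+1%:R.
have e10 : 0 < e1 by rewrite divr_gt0.
have : \forall y \near x0, differentiable F y /\
    forall j, `|'D_(delta_mx 0 j) F x0 - 'D_(delta_mx 0 j) F y| <= e1.
  have cF' : \forall y \near x0, forall j, `|'D_(delta_mx 0 j) F x0 - 'D_(delta_mx 0 j) F y| <= e1.
    have FF := @nbhs_filter _ x0; apply: (filter_forall FF) => j.
    by have /cvgrPdist_le := cF j; apply.
  by near=> y; split; near: y.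
move=> /nbhs_ballP[d /= d0 hd]; exists d => // x y xd yd.
pose u := x - y.
have seg (t : R) : 0 <= t <= 1 -> ball x0 d (y + t *: u).
  move=> t01; rewrite -ball_normE /= distrC.
  have -> : y + t *: u - x0 = segpt (y - x0) (x - x0) t.
    by apply/rowP => i; rewrite !mxE; ring.
  exact: norm_segpt_lt.
apply/rV_norm_le => [|i]; first by rewrite mulr_ge0 // ltW.
have [t|t th] := @mean_value_segment R _ (fun z => F z 0 i) y u 1 ltr01.
  move=> /seg /hd[dFt _]; apply: derivable_coord; exact: diff_derivable.
have [dFt cFt] := hd _ (seg _ th).
have yu : y + u = x by rewrite /u addrC subrK.
rewrite scale1r mulr1 yu derive_coord; last exact: diff_derivable.
move=> E; rewrite -/u.
have dF0 := nbhs_singleton dF.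
have -> : (F x - F y - 'd F x0 u) 0 i = F x 0 i - F y 0 i - 'd F x0 u 0 i.
  by rewrite 2!mxE; congr (_ + _); rewrite !mxE.
rewrite (diff_coord u i dF0) E (deriveE u dFt) (diff_coord u i dFt) -sumrB.
apply: (le_trans (ler_norm_sum _ _ _)).
apply: (@le_trans _ _ (\sum_(j < n) e1 * `|u|)).
  apply: ler_sum => j _; rewrite -mulrBr normrM mulrC.
  apply: ler_pM => //; last by rewrite rV_coord_le.
  apply: le_trans (cFt j); rewrite distrC.
  have := rV_coord_le ('D_(delta_mx 0 j) F x0 - 'D_(delta_mx 0 j) F (y + t *: u)) i.
  by rewrite 2!mxE.
rewrite sumr_const card_ord -mulr_natl mulrA.
apply: ler_wpM2r => //; rewrite /e1 mulrA ler_pdivrMr // mulrC.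
by rewrite ler_pM2l // ler_nat.
Unshelve. all: by end_near. Qed.

End StrictDifferentiability.

(** * Local inverses *)

Lemma mulmx_row_bound (R : realType) n m (B : 'M[R]_(n, m)) :
  exists2 C : R, 0 < C & forall v : 'rV[R]_n, `|v *m B| <= C * `|v|.
Proof.
pose C := \sum_i \sum_j `|B i j| + 1.
have S0 : 0 <= \sum_i \sum_j `|B i j| by apply: sumr_ge0 => i _; exact: sumr_ge0.
exists C => [|v]; first by rewrite ltr_wpDl.
apply/rV_norm_le => [|j]; first by rewrite mulr_ge0 // addr_ge0.
rewrite mxE; apply: (le_trans (ler_norm_sum _ _ _)).
rewrite /C mulrDl mul1r ler_wpDr // mulr_suml.
apply: ler_sum => i _; rewrite normrM mulrC.
apply: ler_pM => //; last exact: rV_coord_le.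
by rewrite (bigD1 j) //= lerDl; apply: sumr_ge0.
Qed.

HB.instance Definition _ (R : realType) (m : nat) := Complete.on 'rV[R]_m.

Section InverseFunction.
Context (R : realType) (m : nat).
Let V := 'rV[R]_m.

(* Apply Banach's fixed point theorem to [x |-> x - (f x - y) A^-1]. *)
Lemma local_inverse (f : V -> V) (x0 : V) (A : 'M[R]_m) :
  A \in unitmx ->
  (forall e : R, 0 < e -> exists2 d : R, 0 < d & forall x y,
    `|x - x0| < d -> `|y - x0| < d ->
    `|f x - f y - (x - y) *m A| <= e * `|x - y|) ->
  forall d0 : R, 0 < d0 ->
  exists r e : R, [/\ 0 < r, r <= d0, 0 < e,
    forall x y, `|x - x0| < r -> `|y - x0| < r -> f x = f y -> x = y &
    exists g : V -> V, [/\ g (f x0) = x0,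
      forall y, `|y - f x0| < e -> `|g y - x0| < r /\ f (g y) = y &
      forall y, `|y - f x0| < e -> {for y, continuous g}]].
Proof.
move=> uA sf d0 d00.
have [C C0 hC] := mulmx_row_bound (invmx A).
(* With this precision [T] below contracts by 1/2, and [f] shrinks distances by at most the factor 1
   / (2 C). *)
have e10 : 0 < (2 * C)^-1 by rewrite invr_gt0 mulr_gt0.
have [d d1 hd] := sf _ e10.
have lip x y : `|x - x0| < d -> `|y - x0| < d -> `|x - y| <= 2 * C * `|f x - f y|.
  move=> xd yd; have k1 := hd _ _ xd yd.
  have k2 : `|x - y| <= C * `|(x - y) *m A|.
    by have := hC ((x - y) *m A); rewrite -mulmxA mulmxV // mulmx1.
  have k3 : `|(x - y) *m A| <= `|f x - f y| + `|f x - f y - (x - y) *m A|.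
    have := ler_normB (f x - f y) (f x - f y - (x - y) *m A).
    by rewrite opprB addrC subrK.
  have : C * `|(x - y) *m A| <= C * (`|f x - f y| + (2 * C)^-1 * `|x - y|).
    by rewrite ler_pM2l //; lra.
  have -> : C * (`|f x - f y| + (2 * C)^-1 * `|x - y|) = C * `|f x - f y| + `|x - y| / 2.
    by field; rewrite gt_eqF.
  lra.
pose r := Num.min d d0; have r0 : 0 < r by rewrite lt_min d1.
have rd : r <= d by rewrite ge_min lexx.
have rd0 : r <= d0 by rewrite ge_min lexx orbT.
(* [T] then moves [x0] by at most C e = r / 4, and the contraction adds at most r / 4, so the closed
   ball of radius r / 2 is preserved. *)
pose e := r / (4 * C); have e0 : 0 < e by rewrite divr_gt0 // mulr_gt0.
pose U := [set x : V | `|x - x0| <= r / 2].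
have U0 : U x0 by rewrite /U /= subrr normr0 ltW // divr_gt0.
have Ur x : U x -> `|x - x0| < r by rewrite /U /= => ?; apply: le_lt_trans; [eassumption|lra].
have cU : closed U.
  apply: (@closed_comp _ _ (fun x : V => `|x - x0|) [set t : R | t <= r / 2]).
    move=> x _; have F := @nbhs_filter _ x.
    apply: (@cvg_norm _ _ _ _ F); apply: (@cvgB _ _ _ _ F); [exact: cvg_id|exact: cvg_cst].
  exact: closed_le.
have sol y : `|y - f x0| < e -> exists2 x, U x & f x = y.
  move=> ye.
  pose T (x : V) : V := x - (f x - y) *m invmx A.
  have Tlip x x' : U x -> U x' -> `|T x - T x'| <= 2^-1 * `|x - x'|.
    move=> Ux Ux'.
    have -> : T x - T x' = - ((f x - f x' - (x - x') *m A) *m invmx A).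
      rewrite mulmxBl -mulmxA mulmxV // mulmx1 opprB /T.
      have -> : (f x - f x') *m invmx A = (f x - y) *m invmx A - (f x' - y) *m invmx A.
        by rewrite -mulmxBl opprB addrA subrK.
      move: ((f x - y) *m _) ((f x' - y) *m _) => a b.
      by apply/rowP => i; rewrite !mxE; ring.
    rewrite normrN; apply: (le_trans (hC _)).
    have : `|f x - f x' - (x - x') *m A| <= (2 * C)^-1 * `|x - x'|.
      by apply: hd; [apply: lt_le_trans (Ur _ Ux) rd|apply: lt_le_trans (Ur _ Ux') rd].
    move=> k; apply: (@le_trans _ _ (C * ((2 * C)^-1 * `|x - x'|))).
      by rewrite ler_pM2l.
    by rewrite mulrA invfM mulrCA divff ?gt_eqF // mulr1.
  have TU : {homo T : x / U x >-> U x}.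
    move=> x Ux; rewrite /U /=.
    have -> : T x - x0 = (T x - T x0) + (T x0 - x0) by rewrite addrA subrK.
    apply: (le_trans (ler_normD _ _)).
    have k1 := Tlip _ _ Ux U0.
    have k2 : `|T x0 - x0| <= r / 4.
      have -> : T x0 - x0 = - ((f x0 - y) *m invmx A) by rewrite /T addrAC subrr add0r.
      rewrite normrN; apply: (le_trans (hC _)); rewrite distrC.
      apply: (@le_trans _ _ (C * e)); first by rewrite ler_pM2l // ltW.
      by rewrite /e le_eqVlt; apply/orP; left; apply/eqP; field; rewrite gt_eqF.
    move: Ux; rewrite /U /=; lra.
  have ctr : is_contraction (mkfun_fun TU).
    exists (2^-1)%:nng; split => /=; first by rewrite invf_lt1 // ltr1n.
    by move=> [x x'] [Ux Ux'] /=; exact: Tlip.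
  have [x Ux /= xT] := banach_fixed_point ctr cU (ex_intro _ x0 U0).
  exists x => //.
  have /(congr1 (fun B => B *m A)) : (f x - y) *m invmx A = 0.
    move: xT; rewrite /mkfun /T => xT.
    have := congr1 (fun w => x - w) xT; rewrite subrr opprB addrC subrK => <-.
    by [].
  by rewrite -mulmxA mulVmx // mulmx1 mul0mx => /eqP; rewrite subr_eq0 => /eqP.
have [g hg] : {g : V -> V & forall y, `|y - f x0| < e -> U (g y) /\ f (g y) = y}.
  apply: (@choice V V (fun y x => `|y - f x0| < e -> U x /\ f x = y)) => y.
  have [ye|ye] := pselect (`|y - f x0| < e); last by exists x0.
  by have [x Ux fx] := sol y ye; exists x.
have inj x y : `|x - x0| < r -> `|y - x0| < r -> f x = f y -> x = y.
  move=> xr yr fxy; have := lip _ _ (lt_le_trans xr rd) (lt_le_trans yr rd).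
  by rewrite fxy subrr normr0 mulr0 normr_le0 subr_eq0 => /eqP.
exists r, e; split => //; exists g; split.
- have [|Ug fg] := hg (f x0); first by rewrite subrr normr0.
  by apply: inj => //; [exact: Ur|rewrite subrr normr0].
- by move=> y /hg[Ug fg]; split => //; exact: Ur.
- move=> y ye; have FF := @nbhs_filter _ y.
  apply: (proj2 (@cvgrPdist_le _ _ _ _ FF _ _)) => /= t t0.
  have h0 : 0 < e - `|y - f x0| by rewrite subr_gt0.
  have k0 : 0 < Num.min (e - `|y - f x0|) (t / (2 * C)).
    by rewrite lt_min h0 divr_gt0 // mulr_gt0.
  apply/nbhs_ballP; exists (Num.min (e - `|y - f x0|) (t / (2 * C))) => //= y'.
  rewrite -ball_normE /= lt_min => /andP[y1 y2].
  have y'e : `|y' - f x0| < e.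
    have -> : y' - f x0 = (y' - y) + (y - f x0) by rewrite addrA subrK.
    by apply: (le_lt_trans (ler_normD _ _)); rewrite distrC; lra.
  have [Ug fg] := hg _ ye; have [Ug' fg'] := hg _ y'e.
  apply: (le_trans (lip _ _ (lt_le_trans (Ur _ Ug) rd) (lt_le_trans (Ur _ Ug') rd))).
  rewrite fg fg'; move: y2; rewrite ltr_pdivlMr ?mulr_gt0 // mulrC => y2.
  exact: ltW.
Qed.

End InverseFunction.

(** * The cone over a parametrized hypersurface *)

Section ConeInverse.
Context (R : realType) (n : nat).

Lemma norm_lsubmx (w : 'rV[R]_(1 + n)) : `|lsubmx w 0 0| <= `|w|.
Proof. by rewrite mxE; exact: rV_coord_le. Qed.

Lemma lsubmxB00 (w w' : 'rV[R]_(1 + n)) :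
  lsubmx (w - w') 0 0 = lsubmx w 0 0 - lsubmx w' 0 0.
Proof. by rewrite !mxE. Qed.

Lemma norm_rsubmx (w : 'rV[R]_(1 + n)) : `|rsubmx w| <= `|w|.
Proof. by apply/rV_norm_le => // i; rewrite mxE; exact: rV_coord_le. Qed.

Lemma norm_row_mx_lt (k : R) (u : 'rV[R]_n) (r : R) : 0 < r -> `|k| < r -> `|u| < r ->
  `|row_mx (k%:M : 'rV[R]_1) u| < r.
Proof.
move=> r0 kr ur; apply/rV_norm_lt => // i; rewrite mxE.
case: (fintype.split i) => j; last exact: le_lt_trans (rV_coord_le _ _) ur.
by rewrite ord1 mxE mulr1n.
Qed.

(* The map [(k, u) |-> k *: L u] has derivative [col_mx (L v0) B] at [(1, v0)]. *)
Lemma cone_local_inverse (L : 'rV[R]_n -> 'rV[R]_n.+1) (v0 : 'rV[R]_n)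
    (B : 'M[R]_(n, n.+1)) (d0 : R) :
  (forall e : R, 0 < e -> exists2 d : R, 0 < d & forall x y,
    `|x - v0| < d -> `|y - v0| < d ->
    `|L x - L y - (x - y) *m B| <= e * `|x - y|) ->
  (forall u k, u *m B = k *: L v0 -> u = 0) -> L v0 <> 0 -> 0 < d0 ->
  exists r e : R, [/\ 0 < r, r <= d0, 0 < e,
    forall u u' k, `|u - v0| < r -> `|u' - v0| < r -> `|k - 1| < r ->
      L u = k *: L u' -> u = u' &
    exists t, t (L v0) = v0 /\ forall y, `|y - L v0| < e ->
      [/\ {for y, continuous t}, `|t y - v0| < r &
         exists2 k : R, 0 < k & y = k *: L (t y)]].
Proof.
move=> sL injB L0 d00.
pose A : 'M[R]_(1 + n) := col_mx (L v0) B.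
pose f (w : 'rV[R]_(1 + n)) : 'rV[R]_(1 + n) := lsubmx w 0 0 *: L (rsubmx w).
pose x0 : 'rV[R]_(1 + n) := row_mx 1%:M v0.
have AE w : w *m A = lsubmx w 0 0 *: L v0 + rsubmx w *m B.
  rewrite -{1}(hsubmxK w) mul_row_col {1}[lsubmx w]mx11_scalar.
  by rewrite mul_scalar_mx.
have lx0 : lsubmx x0 0 0 = 1 by rewrite row_mxKl mxE.
have fx0 : f x0 = L v0 by rewrite /f row_mxKl row_mxKr mxE scale1r.
(* A kernel vector (k, u) satisfies u B = - k L v0, so u = 0 by [injB], and then k = 0 because L v0
   is nonzero. *)
have uA : A \in unitmx.
  rewrite -row_free_unit; apply: inj_row_free => w; rewrite AE => w0.
  have r0 : rsubmx w = 0.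
    by apply: (injB _ (- lsubmx w 0 0)); apply/eqP; rewrite scaleNr -addr_eq0 addrC w0.
  move: w0; rewrite r0 mul0mx addr0 => /eqP; rewrite scaler_eq0 => /orP[/eqP l0|/eqP //].
  by rewrite -(hsubmxK w) r0 [lsubmx w]mx11_scalar l0 raddf0 row_mx0.
have [C C0 hC] := mulmx_row_bound B.
have sf : forall e : R, 0 < e -> exists2 d : R, 0 < d & forall x y,
    `|x - x0| < d -> `|y - x0| < d ->
    `|f x - f y - (x - y) *m A| <= e * `|x - y|.
  move=> e e0; pose K := C + 1; have K0 : 0 < K by rewrite addr_gt0.
  have e40 : 0 < e / 4 by rewrite divr_gt0.
  have [d1 d10 h1] := sL _ e40.
  have [d2 d20 h2] := sL _ ltr01.
  pose d := Num.min (Num.min d1 d2) (e / (4 * K)).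
  have de : d <= e / (4 * K) by rewrite ge_min lexx orbT.
  have dd1 : d <= d1 by rewrite !ge_min lexx.
  have dd2 : d <= d2 by rewrite !ge_min lexx orbT.
  have dp : 0 < d by rewrite !lt_min d10 d20 divr_gt0 // mulr_gt0.
  exists d => // x y xd yd.
  set a := lsubmx x 0 0; set b := lsubmx y 0 0.
  set u := rsubmx x; set v := rsubmx y.
  have Lu : `|u - v0| < d.
    have -> : u - v0 = rsubmx (x - x0) by rewrite linearB /= row_mxKr.
    exact: le_lt_trans (norm_rsubmx _) xd.
  have Lv : `|v - v0| < d.
    have -> : v - v0 = rsubmx (y - x0) by rewrite linearB /= row_mxKr.
    exact: le_lt_trans (norm_rsubmx _) yd.
  have La : `|a - 1| < d.
    have -> : a - 1 = lsubmx (x - x0) 0 0 by rewrite lsubmxB00 lx0.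
    exact: le_lt_trans (norm_lsubmx _) xd.
  have uv : `|u - v| <= `|x - y|.
    have -> : u - v = rsubmx (x - y) by rewrite linearB.
    exact: norm_rsubmx.
  have ab : `|a - b| <= `|x - y|.
    have -> : a - b = lsubmx (x - y) 0 0 by rewrite lsubmxB00.
    exact: norm_lsubmx.
  have LK p q : `|p - v0| < d2 -> `|q - v0| < d2 -> `|L p - L q| <= K * `|p - q|.
    move=> p2 q2; have := h2 _ _ p2 q2; rewrite mul1r => k1.
    have := hC (p - q); rewrite /K mulrDl mul1r => k2.
    have := ler_normD ((p - q) *m B) (L p - L q - (p - q) *m B).
    by rewrite addrC subrK; lra.
  have v00 : `|v0 - v0| < d2 by rewrite subrr normr0.
  have Luv := LK _ _ (lt_le_trans Lu dd2) (lt_le_trans Lv dd2).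
  have Lv0 := LK _ _ (lt_le_trans Lv dd2) v00.
  have h1uv := h1 _ _ (lt_le_trans Lu dd1) (lt_le_trans Lv dd1).
  (* Product rule with remainders: the outer terms are small because a is near 1 and v near v0, the
     middle one by strict differentiability of [L]. *)
  have -> : f x - f y - (x - y) *m A = (a - 1) *: (L u - L v)
      + (L u - L v - (u - v) *m B) + (a - b) *: (L v - L v0).
    rewrite AE /f -/a -/b -/u -/v.
    have -> : rsubmx (x - y) = u - v by rewrite linearB.
    have -> : lsubmx (x - y) 0 0 = a - b by rewrite lsubmxB00.
    move: ((u - v) *m B) => w.
    by apply/rowP => i; rewrite !mxE; ring.
  apply: (le_trans (ler_normD _ _)); apply: (le_trans (lerD (ler_normD _ _) (lexx _))).
  rewrite !normrZ.
  have N0 := normr_ge0 (x - y).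
  have KE : K * (e / (4 * K)) = e / 4 by field; rewrite gt_eqF.
  have dK : K * d <= e / 4 by rewrite -KE ler_pM2l.
  have t1 : `|a - 1| * `|L u - L v| <= e / 4 * `|x - y|.
    apply: (@le_trans _ _ (d * (K * `|x - y|))).
      by apply: ler_pM => //; [exact: ltW|apply: (le_trans Luv); rewrite ler_pM2l].
    by rewrite mulrA [d * K]mulrC; apply: ler_wpM2r.
  have t2 : `|a - b| * `|L v - L v0| <= e / 4 * `|x - y|.
    rewrite mulrC; apply: ler_pM => //; apply: (le_trans Lv0); apply: le_trans dK.
    by rewrite ler_pM2l // ltW.
  have t3 : e / 4 * `|u - v| <= e / 4 * `|x - y| by rewrite ler_pM2l.
  have t4 : 0 <= e / 4 * `|x - y| by rewrite mulr_ge0 // ltW.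
  lra.
(* The bound 1/2 keeps the scalar coordinate close to 1, hence positive. *)
have d0' : 0 < Num.min d0 2^-1 by rewrite lt_min d00 invr_gt0 /=.
have [r [e [r0 rd e0 injf [g [gx0 hg cg]]]]] := local_inverse uA sf d0'.
move: rd; rewrite le_min => /andP[rd rh].
exists r, e; split => //.
  move=> u u' k ur u'r kr Luu'.
  have := injf (row_mx 1%:M u) (row_mx k%:M u').
  have E1 (a : R) (w : 'rV[R]_n) : row_mx a%:M w - x0 = row_mx ((a - 1)%:M : 'rV[R]_1) (w - v0).
    by rewrite /x0 opp_row_mx add_row_mx raddfB.
  rewrite !E1 => /(_ _ _ _) h.
  have /(congr1 rsubmx) : row_mx (1%:M : 'rV[R]_1) u = row_mx k%:M u'.
    apply: h; [|exact: norm_row_mx_lt|].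
      by apply: norm_row_mx_lt => //; rewrite subrr normr0.
    by rewrite /f !row_mxKl !row_mxKr !mxE !mulr1n scale1r.
  by rewrite !row_mxKr.
exists (fun y => rsubmx (g y)); split.
  by rewrite -fx0 gx0 row_mxKr.
rewrite -fx0 => y ye; have [gr fg] := hg y ye; split.
- have c1 := cg y ye.
  have c2 : {for g y, continuous (fun w : 'rV[R]_(1 + n) => rsubmx w)}.
    exact: differentiable_continuous (differentiable_rsubmx _).
  exact: (continuous_comp c1 c2).
- have -> : rsubmx (g y) - v0 = rsubmx (g y - x0) by rewrite linearB /= row_mxKr.
  exact: le_lt_trans (norm_rsubmx _) gr.
- exists (lsubmx (g y) 0 0); last by rewrite -[LHS]fg.
  have : `|lsubmx (g y) 0 0 - 1| < r.
    have -> : lsubmx (g y) 0 0 - 1 = lsubmx (g y - x0) 0 0 by rewrite lsubmxB00 lx0.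
    exact: le_lt_trans (norm_lsubmx _) gr.
  rewrite ltr_norml => /andP[]; lra.
Qed.

End ConeInverse.

(** * Lorentzian algebra *)

(** Pairing a vanishing combination with each [w j] shows these [m] vectors to be independent, hence
    a basis. The signs [s] admit an indefinite form. *)
Lemma orthonormal_full (R : realType) m (b : 'rV[R]_m -> 'rV[R]_m -> R)
    (w : 'I_m -> 'rV[R]_m) (s : 'I_m -> R) (x : 'rV[R]_m) :
  symmetric_bilinear b -> (forall i, s i != 0) ->
  (forall i j, b (w i) (w j) = s i * (i == j)%:R) ->
  (forall i, b x (w i) = 0) -> forall y, b x y = 0.
Proof.
move=> hb s0 bw bx y.
pose W : 'M[R]_m := \matrix_i w i.
have WE (c : 'rV[R]_m) : c *m W = \sum_i c 0 i *: w i.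
  by rewrite mulmx_sum_row; apply: eq_bigr => i _; rewrite rowK.
have uW : W \in unitmx.
  rewrite -row_free_unit; apply: inj_row_free => c; rewrite WE => c0.
  apply/rowP => j; rewrite mxE; apply/eqP.
  have : b (\sum_i c 0 i *: w i) (w j) = 0 by rewrite c0 (sbil0l hb).
  rewrite (sbil_suml hb) (bigD1 j) //= big1 => [|i ij]; last first.
    by rewrite (sbilZl hb) bw (negbTE ij) !mulr0.
  by rewrite (sbilZl hb) bw eqxx mulr1 addr0 => /eqP; rewrite mulf_eq0 (negbTE (s0 j)) orbF.
have -> : y = (y *m invmx W) *m W by rewrite mulmxKV.
rewrite WE (sbil_sumr hb) big1 // => i _.
by rewrite (sbilZr hb) bx mulr0.
Qed.

Section Lorentz.
Context (R : realType) (n : nat).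
Implicit Types x y z : 'rV[R]_n.+2.

Definition lorentz_sign (i : 'I_n.+2) : R := if i == ord0 then -1 else 1.

Lemma lorentzE x y : lorentz x y = \sum_i lorentz_sign i * (x 0 i * y 0 i).
Proof.
rewrite big_ord_recl /lorentz_sign eqxx mulN1r; congr (_ + _).
by apply: eq_bigr => i _; rewrite !mxE eq_sym (negbTE (neq_lift _ _)) mul1r.
Qed.

Lemma lorentz_symmetric_bilinear : symmetric_bilinear (@lorentz R n).
Proof.
split=> [a u v w|u v]; rewrite !lorentzE.
  by rewrite mulr_sumr -big_split /=; apply: eq_bigr => i _; rewrite !mxE; ring.
by apply: eq_bigr => i _; rewrite [u 0 i * _]mulrC.
Qed.
Lemma lorentz_split x y : lorentz x y =
  - (time_part x * time_part y) + edot (space_part x) (space_part y).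
Proof. by []. Qed.

Lemma space_partZ (a : R) x : space_part (a *: x) = a *: space_part x.
Proof. by apply/rowP => i; rewrite !mxE. Qed.

Lemma norm_space_part x : `|space_part x| <= `|x|.
Proof. by apply/rV_norm_le => // i; rewrite mxE; exact: rV_coord_le. Qed.

Lemma minkowski_eq x y : time_part x = time_part y ->
  space_part x = space_part y -> x = y.
Proof.
move=> ht hs; apply/rowP => i; case: (unliftP ord0 i) => [j ->|-> //].
by have := congr1 (fun v : 'rV[R]_n.+1 => v 0 j) hs; rewrite !mxE.
Qed.

(** Pairing [x] with its reflection in the time coordinate gives its Euclidean square. *)
Lemma lorentz_nondegenerate x : (forall y, lorentz x y = 0) -> x = 0.
Proof.
move=> hx.
pose y : 'rV[R]_n.+2 := \row_i (lorentz_sign i * x 0 i).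
have := hx y; rewrite lorentzE => h.
suff : edot x x = 0 by exact: edot_eq0.
rewrite -[RHS]h; apply: eq_bigr => i _; rewrite mxE.
rewrite mulrCA !mulrA; congr (_ * _); rewrite mulrC mulrA.
by rewrite /lorentz_sign; case: ifP => _; rewrite ?mulrN1 ?mulN1r ?opprK ?mulr1 ?mul1r //; ring.
Qed.

(* With [t0], [t] the time parts of [x], [y], positivity of the Euclidean square
   of [t0 *: space_part y - t *: space_part x] is the reverse Cauchy-Schwarz
   inequality. *)
Lemma spacelike_of_orthogonal x y : lorentz x x = -1 -> lorentz x y = 0 -> y != 0 ->
  0 < lorentz y y.
Proof.
rewrite !lorentz_split => xx xy y0.
set t0 := time_part x in xx xy *; set t := time_part y in xy *.
set X := space_part x in xx xy *; set Y := space_part y in xy *.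
have := edot_ge0 (t0 *: Y - t *: X).
have -> : edot (t0 *: Y - t *: X) (t0 *: Y - t *: X) =
   t0 ^+ 2 * edot Y Y - 2 * t0 * t * edot X Y + t ^+ 2 * edot X X.
  rewrite -scaleNr !edotDl !edotDr !edotZl !edotZr (edotC Y X); ring.
have XX : edot X X = t0 * t0 - 1 by lra.
have XY : edot X Y = t0 * t by lra.
rewrite XX XY => h.
have X0 := edot_ge0 X; have Y0 := edot_ge0 Y.
have t01 : 1 <= t0 ^+ 2 by rewrite expr2; lra.
have [t00|t00] := eqVneq t 0.
  have : edot Y Y != 0.
    apply: contra_neq y0 => /edot_eq0 Y00; apply: minkowski_eq.
      by rewrite -/t t00 /time_part mxE.
    by rewrite -/Y Y00; apply/rowP => i; rewrite !mxE.
  by rewrite t00 mulr0 oppr0 add0r lt_def Y0 andbT.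
have t2 : 0 < t ^+ 2 by rewrite lt_def sqr_ge0 andbT sqrf_eq0.
(* The inequality [h] now reads t0^2 (edot Y Y - t^2) >= t^2. *)
have : 0 < t0 ^+ 2 * (edot Y Y - t * t) by nra.
by rewrite pmulr_rgt0; lra.
Qed.

End Lorentz.

Section LorentzCalculus.
Context (R : realType) (n : nat) (V : normedModType R).

Lemma is_derive_lorentz (f g : V -> 'rV[R]_n.+2) x v :
  derivable f x v -> derivable g x v ->
  is_derive x v (fun u => lorentz (f u) (g u))
    (lorentz ('D_v f x) (g x) + lorentz (f x) ('D_v g x)).
Proof.
move=> df dg.
have -> : (fun u => lorentz (f u) (g u)) =
    \sum_(i < n.+2) (fun u => lorentz_sign R i * (f u 0 i * g u 0 i)).
  by apply/funext => u; rewrite lorentzE fct_sumE.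
have -> : lorentz ('D_v f x) (g x) + lorentz (f x) ('D_v g x) =
    \sum_(i < n.+2) (lorentz_sign R i * ('D_v f x 0 i * g x 0 i + f x 0 i * 'D_v g x 0 i)).
  by rewrite !lorentzE -big_split; apply: eq_bigr => i _; rewrite mulrDr.
apply: is_derive_sum => i.
have fi : is_derive x v (fun u => f u 0 i) ('D_v f x 0 i).
  by apply: DeriveDef; [exact: derivable_coord|exact: derive_coord].
have gi : is_derive x v (fun u => g u 0 i) ('D_v g x 0 i).
  by apply: DeriveDef; [exact: derivable_coord|exact: derive_coord].
have fg := is_deriveM fi gi.
have H : is_derive x v (fun u => lorentz_sign R i * (f u 0 i * g u 0 i)) _ :=
  is_deriveZ (lorentz_sign R i) fg.
apply: (is_derive_eq H).
by rewrite -[_ *: _]/(_ * _); congr (_ * _); rewrite addrC -![_ *: _]/(_ * _) [g x 0 i * _]mulrC.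
Qed.

Lemma derive_lorentz_cst (f g : V -> 'rV[R]_n.+2) x v (c : R) :
  differentiable f x -> differentiable g x ->
  (\forall u \near x, lorentz (f u) (g u) = c) ->
  lorentz ('d f x v) (g x) + lorentz (f x) ('d g x v) = 0.
Proof.
move=> df dg hc.
have := is_derive_lorentz (diff_derivable (v := v) df) (diff_derivable (v := v) dg).
move=> /(@derive_val _ _ _ _ _ _ _).
rewrite (deriveE v df) (deriveE v dg) => <-.
by rewrite (near_eq_derive v hc) derive_cst.
Qed.

End LorentzCalculus.

(** * The Gauss map in a chart *)

Section ChartBasics.
Context (R : realType) (n : nat) (M : topologicalType) (c : chart R n M).

Lemma chart_imageP u : chart_image c u ->
  chart_dom c (chart_inv c u) /\ chart_map c (chart_inv c u) = u.
Proof. by move=> [q qd <-]; rewrite chart_mapK. Qed.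

Lemma nbhs_chart_image u : chart_image c u -> nbhs u (chart_image c).
Proof. by move=> cu; apply: open_nbhs_nbhs; split => //; exact: chart_image_open. Qed.

Lemma nbhs_chart_dom p : chart_dom c p -> nbhs p (chart_dom c).
Proof. by move=> cp; apply: open_nbhs_nbhs; split => //; exact: chart_dom_open. Qed.

Lemma chart_map_continuous_at p : chart_dom c p -> {for p, continuous (chart_map c)}.
Proof.
move=> cp; have := @chart_map_continuous _ _ _ c.
by rewrite continuous_open_subspace; [apply; rewrite inE|exact: chart_dom_open].
Qed.

Lemma chart_inv_continuous_at u : chart_image c u -> {for u, continuous (chart_inv c)}.
Proof.
move=> cu; have := @chart_inv_continuous _ _ _ c.
by rewrite continuous_open_subspace; [apply; rewrite inE|exact: chart_image_open].
Qed.

End ChartBasics.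

(** * Fundamental forms and principal curvatures in a chart *)

Section Immersed.
Context (R : realType) (n : nat) (M : topologicalType) (A : set (chart R n M)).
Context (phi eta : M -> 'rV[R]_n.+2).
Hypotheses (himm : immersion A phi) (hnormal : unit_normal_field A phi eta).
Hypothesis hconvex : uniformly_horospherically_convex A phi eta.
Context (c : chart R n M) (p : M).
Hypotheses (Ac : A c) (cp : chart_dom c p).

Let V := 'rV[R]_n.
Let u0 : V := chart_map c p.
Let f : V -> 'rV[R]_n.+2 := phi \o chart_inv c.
Let h : V -> 'rV[R]_n.+2 := eta \o chart_inv c.
Let hl := lorentz_symmetric_bilinear R n.

Lemma base_in_image : chart_image c u0. Proof. by exists p. Qed.

Let invu0 : chart_inv c u0 = p. Proof. exact: chart_mapK. Qed.
Let fu0 : f u0 = phi p. Proof. by rewrite /f /= invu0. Qed.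
Let hu0 : h u0 = eta p. Proof. by rewrite /h /= invu0. Qed.

Lemma smooth_phi : smooth_on (chart_image c) f.
Proof. by case: himm => _ sphi _; exact: sphi. Qed.

Lemma smooth_eta : smooth_on (chart_image c) h.
Proof. by case: hnormal => seta _; exact: seta. Qed.

Let df u : chart_image c u -> differentiable f u.
Proof. exact: (smooth_phi [::]). Qed.
Let dh u : chart_image c u -> differentiable h u.
Proof. exact: (smooth_eta [::]). Qed.
Let ddf v u : chart_image c u -> differentiable ('D_v f) u.
Proof. exact: (smooth_phi [:: v]). Qed.

Lemma near_image (P : set V) : (forall u, chart_image c u -> P u) ->
  \forall u \near u0, P u.
Proof. by move=> hP; apply: filterS (nbhs_chart_image base_in_image). Qed.

Lemma lorentz_eta_diff_phi u v : chart_image c u -> lorentz (h u) ('d f u v) = 0.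
Proof.
move=> /chart_imageP[qd qu]; have [_ /(_ (chart_inv c u))[_ _ /(_ c v Ac qd)]] := hnormal.
by rewrite /diff_in qu.
Qed.

Let D := 'd f u0 : V -> 'rV[R]_n.+2.
Let N := 'd h u0 : V -> 'rV[R]_n.+2.

Let DD a u v : D (a *: u + v) = a *: D u + D v.
Proof. by rewrite /D linearP. Qed.
Let ND a u v : N (a *: u + v) = a *: N u + N v.
Proof. by rewrite /N linearP. Qed.

Let phiphi : lorentz (phi p) (phi p) = -1.
Proof. by case: himm => /(_ p)[]. Qed.
Let etaeta : lorentz (eta p) (eta p) = 1.
Proof. by case: hnormal => _ /(_ p)[]. Qed.
Let etaphi : lorentz (eta p) (phi p) = 0.
Proof. by case: hnormal => _ /(_ p)[]. Qed.
Let etaD v : lorentz (eta p) (D v) = 0.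
Proof. by rewrite -hu0; exact: lorentz_eta_diff_phi base_in_image. Qed.

Let phiD v : lorentz (phi p) (D v) = 0.
Proof.
have := @derive_lorentz_cst R n V f f u0 v (-1) (df base_in_image) (df base_in_image).
rewrite (hl.2 ('d f u0 v)) fu0 => H.
have : lorentz (phi p) (D v) + lorentz (phi p) (D v) = 0.
  by apply: H; apply: near_image => u _; case: himm => /(_ (chart_inv c u))[].
lra.
Qed.

Let etaN v : lorentz (eta p) (N v) = 0.
Proof.
have := @derive_lorentz_cst R n V h h u0 v 1 (dh base_in_image) (dh base_in_image).
rewrite (hl.2 ('d h u0 v)) hu0 => H.
have : lorentz (eta p) (N v) + lorentz (eta p) (N v) = 0.
  by apply: H; apply: near_image => u _; case: hnormal => _ /(_ (chart_inv c u))[].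
lra.
Qed.

Let phiN v : lorentz (phi p) (N v) = 0.
Proof.
have E : lorentz (N v) (f u0) + lorentz (h u0) (D v) = 0.
  apply: (@derive_lorentz_cst R n V h f u0 v 0 (dh base_in_image) (df base_in_image)).
  by apply: near_image => u _; case: hnormal => _ /(_ (chart_inv c u))[].
by move: E; rewrite fu0 hu0 etaD addr0 hl.2.
Qed.

Lemma second_derivative_symmetric v w : 'D_v ('D_w f) u0 = 'D_w ('D_v f) u0.
Proof.
apply/rowP => i.
have d1 : derivable ('D_w f) u0 v := diff_derivable (ddf w base_in_image).
have d2 : derivable ('D_v f) u0 w := diff_derivable (ddf v base_in_image).
transitivity ('D_v (fun u => 'D_w f u 0 i) u0); first exact: esym (derive_coord i d1).
transitivity ('D_w (fun u => 'D_v f u 0 i) u0); last exact: derive_coord i d2.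
have coordf z : \forall y \near u0, derivable (fun u => f u 0 i) y z /\
    'D_z (fun u => f u 0 i) y = 'D_z f y 0 i.
  apply: near_image => u cu; have dfu : derivable f u z := diff_derivable (df cu).
  by split; [exact: derivable_coord|exact: derive_coord].
apply: (derive_comm (coordf w) (coordf v)).
- apply: (@differentiable_comp _ _ _ _ ('D_w f) (fun x : 'rV[R]_n.+2 => x 0 i)).
    exact: ddf base_in_image.
  exact: differentiable_coord.
- apply: (@differentiable_comp _ _ _ _ ('D_v f) (fun x : 'rV[R]_n.+2 => x 0 i)).
    exact: ddf base_in_image.
  exact: differentiable_coord.
Qed.

(* Differentiating [lorentz eta (dphi w) = 0] expresses the second fundamental
   form through second derivatives of [phi], whence its symmetry. *)
Lemma second_fundamental_form v w :
  lorentz (N v) (D w) = - lorentz (eta p) ('D_v ('D_w f) u0).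
Proof.
have E : lorentz (N v) ('D_w f u0) + lorentz (h u0) ('d ('D_w f) u0 v) = 0.
  apply: (@derive_lorentz_cst R n V h ('D_w f) u0 v 0 (dh base_in_image) (ddf w base_in_image)).
  apply: near_image => u cu.
  have Eu : 'D_w f u = 'd f u w := deriveE w (df cu).
  by rewrite Eu; exact: lorentz_eta_diff_phi.
have E1 : 'D_w f u0 = D w := deriveE w (df base_in_image).
have E2 : 'D_v ('D_w f) u0 = 'd ('D_w f) u0 v := deriveE v (ddf w base_in_image).
move: E; rewrite E1 hu0 -E2 => /eqP; rewrite addr_eq0 => /eqP; exact.
Qed.

Let g u v := lorentz (D u) (D v).
(** The second fundamental form, with the sign that makes its eigenvalues relative to [g] the
    principal curvatures. *)
Let b u v := - lorentz (N u) (D v).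

Lemma first_form_bilinear : symmetric_bilinear g.
Proof.
split=> [a u v w|u v]; last by rewrite /g hl.2.
by rewrite /g DD hl.1.
Qed.

Lemma second_form_bilinear : symmetric_bilinear b.
Proof.
split=> [a u v w|u v]; first by rewrite /b ND hl.1; ring.
by rewrite /b !second_fundamental_form second_derivative_symmetric.
Qed.

Lemma first_form_pos v : v != 0 -> 0 < g v v.
Proof.
move=> v0; apply: (spacelike_of_orthogonal phiphi (phiD v)).
apply: contra_neq v0 => Dv0.
case: himm => _ _ /(_ c p Ac cp); apply; rewrite /diff_in.
by rewrite -[LHS]/(D v) Dv0 linear0.
Qed.

(** [phi p], [eta p] and the [D (e i)] are n + 2 pairwise orthogonal vectors of square -1 or 1,
    hence a basis. *)
Lemma tangent_normal_basis e (x : 'rV[R]_n.+2) :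
  (forall i j : 'I_n, g (e i) (e j) = (i == j)%:R) ->
  lorentz x (phi p) = 0 -> lorentz x (eta p) = 0 ->
  (forall i, lorentz x (D (e i)) = 0) -> x = 0.
Proof.
move=> ge xphi xeta xD; apply: lorentz_nondegenerate.
(* [phi p] sits at index 0, so that the squares match [lorentz_sign]. *)
pose w (i : 'I_n.+2) : 'rV[R]_n.+2 :=
  if unlift ord0 i is Some j then
    if unlift ord0 j is Some k then D (e k) else eta p
  else phi p.
apply: (@orthonormal_full R n.+2 (@lorentz R n) w (@lorentz_sign R n)) => //.
- by move=> i; rewrite /lorentz_sign; case: ifP => _; rewrite ?oppr_eq0 oner_eq0.
- have neqs (m : nat) (k : 'I_m) : (ord0 == lift ord0 k) = false.
    by apply/negbTE; exact: neq_lift.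
  move=> i j; rewrite /w /lorentz_sign.
  case: (unliftP ord0 i) => [i' ->|->]; case: (unliftP ord0 j) => [j' ->|->].
  + rewrite (inj_eq lift_inj) eq_sym neqs mul1r.
    case: (unliftP ord0 i') => [k ->|->]; case: (unliftP ord0 j') => [l ->|->].
    * by rewrite (inj_eq lift_inj); exact: ge.
    * by rewrite hl.2 etaD eq_sym neqs.
    * by rewrite etaD neqs.
    * by rewrite etaeta eqxx.
  + rewrite eq_sym neqs mulr0.
    case: (unliftP ord0 i') => [k _|_]; last exact: etaphi.
    by rewrite hl.2 phiD.
  + rewrite neqs mulr0.
    case: (unliftP ord0 j') => [k _|_]; first by rewrite phiD.
    by rewrite hl.2 etaphi.
  + by rewrite !eqxx mulr1 phiphi.
- move=> i; rewrite /w; case: (unliftP ord0 i) => [i' _|_] //.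
  by case: (unliftP ord0 i') => [k _|_].
Qed.

(** An eigenbasis of the second form relative to the first consists of principal directions: N (e j)
    + kappa j D (e j) is orthogonal to the whole frame, hence 0. This makes the convexity hypothesis
    applicable to [kappa]. *)
Lemma exists_principal_basis : exists (e : 'I_n -> V) (kappa : 'I_n -> R),
  [/\ forall i j, g (e i) (e j) = (i == j)%:R,
      forall i v, b (e i) v = kappa i * g (e i) v &
      forall i, kappa i < 1].
Proof.
have [e [kappa [ge be]]] :=
  exists_eigenbasis first_form_bilinear second_form_bilinear first_form_pos.
exists e, kappa; split; [exact: ge|exact: be|move=> i].
have [kappa0 k1 hk] := hconvex.
have weingarten j : N (e j) = - kappa j *: D (e j).
  apply/eqP; rewrite -subr_eq0 scaleNr opprK; apply/eqP.
  apply: (tangent_normal_basis ge).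
  - by rewrite hl.2 sbilDr // phiN sbilZr // phiD mulr0 addr0.
  - by rewrite hl.2 sbilDr // etaN sbilZr // etaD mulr0 addr0.
  - move=> k; rewrite sbilDl // sbilZl //.
    have := be j (e k); rewrite /b /g => <-.
    by rewrite subrr.
have pc : principal_curvatures phi eta c p kappa.
  by exists e; split; [exact: ge|exact: weingarten].
by apply: le_lt_trans k1; exact: (hk c p kappa Ac cp pc).
Qed.

(* As [kappa i < 1], the differential of the null vector [phi + eta] is
   injective modulo the direction of [phi + eta] itself. *)
Lemma horospherical_differential_injective (u : V) (k : R) :
  0 < time_part (phi p + eta p) ->
  space_part (D u + N u) = k *: space_part (phi p + eta p) -> u = 0.
Proof.
set l := phi p + eta p => t0 hs.
have ll : lorentz l l = 0.
  rewrite /l sbilDl // !sbilDr // phiphi etaphi (hl.2 (phi p)) etaphi etaeta; ring.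
have dl : lorentz (D u + N u) l = 0.
  move: (D u) (N u) (phiD u) (etaD u) (phiN u) (etaN u) => x y e1 e2 e3 e4.
  rewrite hl.2 /l (sbilDl hl) (sbilDr hl x) (sbilDr hl x).
  by rewrite e1 e2 e3 e4 !addr0.
(* Proportionality of the space parts extends to the time parts, since [l] is null and orthogonal to
   D u + N u. *)
have DN : D u + N u = k *: l.
  apply: minkowski_eq; last by rewrite hs space_partZ.
  have -> : time_part (k *: l) = k * time_part l by rewrite /time_part mxE.
  move: ll dl; rewrite !lorentz_split hs edotZl => ll dl.
  have : time_part l * (time_part (D u + N u) - k * time_part l) = 0 by nra.
  by move=> /eqP; rewrite mulf_eq0 gt_eqF //= subr_eq0 => /eqP.
have [e [kappa [ge be k1]]] := exists_principal_basis.
(* [l] is normal to the hypersurface, so pairing with D (e i) leaves (1 - kappa i) g u (e i) = 0. *)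
have gu i : g u (e i) = 0.
  have : lorentz (D u + N u) (D (e i)) = 0.
    rewrite DN; move: (D (e i)) (phiD (e i)) (etaD (e i)) => x e1 e2.
    by rewrite (sbilZl hl) /l (sbilDl hl) e1 e2 addr0 mulr0.
  rewrite (sbilDl hl) => E1.
  have E2 : b u (e i) = kappa i * g u (e i).
    by rewrite second_form_bilinear.2 first_form_bilinear.2.
  have E3 : g u (e i) - b u (e i) = 0 by rewrite /b opprK.
  have : (1 - kappa i) * g u (e i) = 0.
    by move: (g u (e i)) (b u (e i)) E2 E3 => x y -> E3; rewrite mulrBl mul1r.
  by move=> /eqP; rewrite mulf_eq0 subr_eq0 gt_eqF //= => /eqP.
have guu : g u u = 0.
  apply: (@orthonormal_full R n g e (fun=> 1)) => //.
  - exact: first_form_bilinear.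
  - by move=> i j; rewrite mul1r; exact: ge.
apply/eqP; apply: contraT => /first_form_pos; by rewrite guu ltxx.
Qed.

End Immersed.

(** * The Gauss map, locally and near infinity *)

Lemma cvg_of_harmonic (R : realType) m (u : nat -> 'rV[R]_m) (x : 'rV[R]_m) :
  (forall j, `|u j - x| < j.+1%:R^-1) -> u j @[j --> \oo] --> x.
Proof.
move=> h; apply/cvgrPdist_lt => e e0.
near=> j; rewrite distrC; apply: (lt_trans (h j)).
by near: j; exact: (near_infty_natSinv_lt (PosNum e0)).
Unshelve. all: by end_near. Qed.

Lemma exists_natSinv_lt (R : realType) (e : R) : 0 < e ->
  exists j : nat, j.+1%:R^-1 < e.
Proof.
move=> e0; have [N _ /(_ N (leqnn N)) hN] := near_infty_natSinv_lt (PosNum e0).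
by exists N.
Qed.

Section NullVector.
Context (R : realType) (n : nat).

Lemma time_part_null (x : 'rV[R]_n.+1) : time_part (null_vector x) = 1.
Proof. by rewrite /time_part mxE unlift_none. Qed.

Lemma space_part_null (x : 'rV[R]_n.+1) : space_part (null_vector x) = x.
Proof. by apply/rowP => i; rewrite !mxE liftK. Qed.

Lemma continuous_time_part : continuous (@time_part R n).
Proof. by move=> x; exact: coord_continuous. Qed.

Definition space_mx : 'M[R]_(n.+2, n.+1) := \matrix_(i, j) (i == lift ord0 j)%:R.

Lemma space_mxE (x : 'rV[R]_n.+2) : x *m space_mx = space_part x.
Proof.
apply/rowP => j; rewrite !mxE (bigD1 (lift ord0 j)) //= big1 => [|i ij].
  by rewrite mxE eqxx mulr1 addr0.
by rewrite mxE (negbTE ij) mulr0.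
Qed.

Lemma space_part_diff (x x' y y' a b : 'rV[R]_n.+2) :
  space_part (x + y) - space_part (x' + y') - space_part (a + b) =
  space_part ((x - x' - a) + (y - y' - b)).
Proof. by apply/rowP => i; rewrite !mxE; ring. Qed.

Lemma mul_rV_space_lin1 m (D N : {linear 'rV[R]_m -> 'rV[R]_n.+2}) u :
  u *m ((lin1_mx D + lin1_mx N) *m space_mx) = space_part (D u + N u).
Proof. by rewrite mulmxA mulmxDr !mul_rV_lin1 space_mxE. Qed.

Lemma continuous_space_part : continuous (@space_part R n).
Proof.
move=> x; have F := @nbhs_filter _ x.
apply: (proj2 (@cvgrPdist_lt _ _ _ _ F _ _)) => e e0.
apply/nbhs_ballP; exists e => //= y; rewrite -ball_normE /= => xy.
apply: le_lt_trans xy.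
have -> : space_part x - space_part y = space_part (x - y).
  by apply/rowP => i; rewrite !mxE.
exact: norm_space_part.
Qed.

End NullVector.

Lemma smooth_map_continuous (R : realType) n (M : topologicalType)
    (A : set (chart R n M)) (W : normedModType R) (f : M -> W) :
  smooth_atlas A -> smooth_map A f -> continuous f.
Proof.
move=> [cov _] sf p; have [c Ac cp] := cov p.
have df : differentiable (f \o chart_inv c) (chart_map c p).
  by apply: (sf c Ac [::]); exists p.
have cf := differentiable_continuous df.
have := continuous_comp (chart_map_continuous_at cp) cf.
apply: continuous_at_eq_near (nbhs_chart_dom cp) _ => q qd.
by rewrite /= chart_mapK.
Qed.

Section GaussMap.
Context (R : realType) (n : nat) (M : topologicalType) (A : set (chart R n M)).
Context (phi eta : M -> 'rV[R]_n.+2) (G : M -> 'rV[R]_n.+1).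
Hypotheses (hA : smooth_atlas A).
Hypotheses (himm : immersion A phi) (hnormal : unit_normal_field A phi eta).
Hypothesis hG : is_gauss_map phi eta G.

Let l p := phi p + eta p.

Lemma gauss_time_gt0 p : 0 < time_part (l p).
Proof.
have [_ [rho]] := hG p; rewrite /l => ->.
have -> : time_part (expR rho *: null_vector (G p)) = expR rho * time_part (null_vector (G p)).
  by rewrite /time_part mxE.
by rewrite time_part_null mulr1 expR_gt0.
Qed.

Lemma gauss_spaceE p : space_part (l p) = time_part (l p) *: G p.
Proof.
have [_ [rho]] := hG p; rewrite /l => ->; rewrite space_partZ space_part_null.
congr (_ *: _).
have -> : time_part (expR rho *: null_vector (G p)) = expR rho * time_part (null_vector (G p)).
  by rewrite /time_part mxE.
by rewrite time_part_null mulr1.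
Qed.

Lemma continuous_null_sum : continuous l.
Proof.
case: himm => _ sphi _; case: hnormal => seta _ p; apply: cvgD.
  exact: (smooth_map_continuous hA sphi).
exact: (smooth_map_continuous hA seta).
Qed.

Lemma gaussE p : G p = (time_part (l p))^-1 *: space_part (l p).
Proof. by rewrite gauss_spaceE scalerA mulVf ?scale1r // gt_eqF // gauss_time_gt0. Qed.

Lemma continuous_gauss_time : continuous (fun p => time_part (l p)).
Proof.
move=> p; apply: (continuous_comp (continuous_null_sum (x := p))).
exact: continuous_time_part.
Qed.

Lemma continuous_gauss : continuous G.
Proof.
have -> : G = fun p => (time_part (l p))^-1 *: space_part (l p).
  by apply/funext => p; exact: gaussE.
move=> p; apply: cvgZ.
  apply: cvgV; first by rewrite gt_eqF // gauss_time_gt0.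
  exact: continuous_gauss_time.
apply: (continuous_comp (continuous_null_sum (x := p))).
exact: continuous_space_part.
Qed.

Hypothesis hconvex : uniformly_horospherically_convex A phi eta.

(** Taking space parts lands in dimension n + 1, so scalar and chart coordinates together give a map
    between spaces of equal dimension, to which [cone_local_inverse] applies. *)
Lemma gauss_local_inverse p : exists (c : chart R n M) (r e : R),
  [/\ chart_dom c p, 0 < r, 0 < e,
    forall u, `|u - chart_map c p| < r -> chart_image c u &
    (forall u u' k, `|u - chart_map c p| < r -> `|u' - chart_map c p| < r ->
       `|k - 1| < r ->
       space_part (l (chart_inv c u)) = k *: space_part (l (chart_inv c u')) -> u = u') /\
    exists t, t (space_part (l p)) = chart_map c p /\
      forall y, `|y - space_part (l p)| < e ->
      [/\ {for y, continuous t}, `|t y - chart_map c p| < r &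
         exists2 k : R, 0 < k & y = k *: space_part (l (chart_inv c (t y)))]].
Proof.
have [c Ac cp] := hA.1 p.
set u0 := chart_map c p.
have iu0 : chart_image c u0 by exists p.
have invu0 : chart_inv c u0 = p by exact: chart_mapK.
pose f := phi \o chart_inv c; pose h := eta \o chart_inv c.
have sf : smooth_on (chart_image c) f by case: himm => _ s _; exact: s.
have sh : smooth_on (chart_image c) h by case: hnormal => s _; exact: s.
pose L u := space_part (l (chart_inv c u)).
pose B := (lin1_mx ('d f u0) + lin1_mx ('d h u0)) *m space_mx R n.
have BE u : u *m B = space_part ('d f u0 u + 'd h u0 u).
  exact: mul_rV_space_lin1.
have [d /= d0 hd] : exists2 d : R, 0 < d & forall u, `|u - u0| < d -> chart_image c u.
  have /nbhs_ballP[d /= d0 hd] := nbhs_chart_image iu0.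
  exists d => // u ud; apply: hd; by rewrite -ball_normE /= distrC.
have strict (g : 'rV[R]_n -> 'rV[R]_n.+2) : smooth_on (chart_image c) g ->
    forall e : R, 0 < e -> exists2 d : R, 0 < d & forall x y,
    `|x - u0| < d -> `|y - u0| < d -> `|g x - g y - 'd g u0 (x - y)| <= e * `|x - y|.
  move=> sg; apply: strict_differentiability.
    by apply: filterS (nbhs_chart_image iu0) => u iu; exact: (sg [::]).
  by move=> j; apply: differentiable_continuous; exact: (sg [:: delta_mx 0 j]).
have sL : forall e : R, 0 < e -> exists2 d : R, 0 < d & forall x y,
    `|x - u0| < d -> `|y - u0| < d ->
    `|L x - L y - (x - y) *m B| <= e * `|x - y|.
  move=> e e0; have e20 : 0 < e / 2 by rewrite divr_gt0.
  have [d1 d10 h1] := strict f sf _ e20.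
  have [d2 d20 h2] := strict h sh _ e20.
  exists (Num.min d1 d2); first by rewrite lt_min d10.
  move=> x y; rewrite !lt_min => /andP[x1 x2] /andP[y1 y2].
  have k1 := h1 _ _ x1 y1; have k2 := h2 _ _ x2 y2.
  rewrite BE.
  have -> : L x - L y - space_part ('d f u0 (x - y) + 'd h u0 (x - y)) =
      space_part ((f x - f y - 'd f u0 (x - y)) + (h x - h y - 'd h u0 (x - y))).
    exact: space_part_diff.
  apply: (le_trans (norm_space_part _)); apply: (le_trans (ler_normD _ _)).
  have -> : e * `|x - y| = e / 2 * `|x - y| + e / 2 * `|x - y| by rewrite -mulrDl -splitr.
  exact: lerD k1 k2.
have injB u k : u *m B = k *: L u0 -> u = 0.
  rewrite BE /L invu0 => hu.
  exact: (horospherical_differential_injective himm hnormal hconvex Ac cp (gauss_time_gt0 p) hu).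
have L0 : L u0 <> 0.
  rewrite /L invu0 gauss_spaceE => /eqP; rewrite scaler_eq0 gt_eqF ?gauss_time_gt0 //= => /eqP G0.
  have [G1 _] := hG p; move: G1; rewrite /sphere /= G0.
  by rewrite -(scale0r (0 : 'rV[R]_n.+1)) enormZ normr0 mul0r => /esym/eqP; rewrite oner_eq0.
have [r [e [r0 rd e0 inj [t [t0 ht]]]]] := cone_local_inverse sL injB L0 d0.
exists c, r, e; split => //.
  by move=> u ur; apply: hd; exact: lt_le_trans rd.
split; first exact: inj.
have Lp : space_part (l p) = L u0 by rewrite /L invu0.
by exists t; rewrite Lp; split.
Qed.

(** Equal values of [G] mean proportional space parts, with a quotient of time parts as factor; near
    [p] this factor is close to 1, as the local inverse requires. *)
Lemma gauss_locally_injective (p : M) : exists2 U : set M, nbhs p U &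
  forall x x', U x -> U x' -> G x = G x' -> x = x'.
Proof.
have [c [r [e [cp r0 e0 im [inj _]]]]] := gauss_local_inverse p.
pose tau q := time_part (l q).
have tp : 0 < tau p by exact: gauss_time_gt0.
pose r' := Num.min r 1; have r'0 : 0 < r' by rewrite lt_min r0 ltr01.
have r'1 : r' <= 1 by rewrite ge_min lexx orbT.
have r'r : r' <= r by rewrite ge_min lexx.
(* Differences of time parts stay below 2 d = tau p r' / 2 and time parts above 3/4 of tau p, so the
   quotient is within r' of 1. *)
pose d := tau p * r' / 4.
have d0 : 0 < d by rewrite divr_gt0 // mulr_gt0.
exists (chart_dom c `&` ((fun q => chart_map c q) @^-1` ball (chart_map c p) r `&`
    tau @^-1` ball (tau p) d)).
  apply: filterI; first exact: nbhs_chart_dom.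
  apply: filterI.
    by apply: (chart_map_continuous_at cp); exact: nbhsx_ballx.
  by apply: (continuous_gauss_time (x := p)); exact: nbhsx_ballx.
move=> x x' [xd [xr xt]] [x'd [x'r x't]] Gxx'.
move: xr xt x'r x't; rewrite /preimage /= -!ball_normE /=.
rewrite [`|_ - chart_map c x|]distrC [`|_ - chart_map c x'|]distrC.
rewrite [`|_ - tau x|]distrC [`|_ - tau x'|]distrC => xr xt x'r x't.
have tx' : 0 < tau x' by exact: gauss_time_gt0.
have : chart_map c x = chart_map c x'.
  apply: (inj _ _ (tau x / tau x')) => //; last first.
    by rewrite !chart_mapK // !gauss_spaceE Gxx' scalerA mulfVK // gt_eqF.
  have -> : tau x / tau x' - 1 = (tau x - tau x') / tau x' by field; rewrite gt_eqF.
  rewrite normrM [X in _ * X]gtr0_norm ?invr_gt0 // ltr_pdivrMr //.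
  have k1 : `|tau x - tau x'| < 2 * d.
    have -> : tau x - tau x' = (tau x - tau p) - (tau x' - tau p) by ring.
    by apply: (le_lt_trans (ler_normB _ _)); lra.
  have k2 : tau p - d < tau x' by move: x't; rewrite ltr_norml => /andP[]; lra.
  apply: (lt_le_trans k1); rewrite /d.
  have k3 : tau p * 3 / 4 <= tau x'.
    have k4 : tau p * r' <= tau p by rewrite ger_pMr.
    by move: k2; rewrite /d; lra.
  apply: (@le_trans _ _ (r' * tau x')); last by rewrite ler_pM2r.
  apply: (@le_trans _ _ (r' * (tau p * 3 / 4))); last by rewrite ler_pM2l.
  have k5 : 0 < r' * tau p by rewrite mulr_gt0.
  by lra.
by move=> /(congr1 (chart_inv c)); rewrite !chart_mapK.
Qed.

Lemma gauss_local_section p : exists2 e : R, 0 < e &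
  exists2 s, s (G p) = p & ray_section G (ball (G p) e) s.
Proof.
have [c [r [e [cp r0 e0 im [_ [t [tp ht]]]]]]] := gauss_local_inverse p.
have k0 := gauss_time_gt0 p; set k := time_part (l p) in k0.
exists (e / k); first by rewrite divr_gt0.
exists (fun y => chart_inv c (t (k *: y))).
  by rewrite -gauss_spaceE tp chart_mapK.
move=> y; rewrite -ball_normE /= distrC => yG.
have ky : `|k *: y - space_part (l p)| < e.
  by rewrite gauss_spaceE -scalerBr normrZ gtr0_norm // mulrC -ltr_pdivlMr.
have [ct tr [j j0 jE]] := ht _ ky; split.
  have c1 : {for y, continuous (fun y : 'rV[R]_n.+1 => k *: y)}.
    exact: scaler_continuous.
  have c2 := continuous_comp c1 ct.
  have c3 : {for (t \o (fun y : 'rV[R]_n.+1 => k *: y)) y, continuous (chart_inv c)}.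
    by apply: chart_inv_continuous_at; exact: im.
  exact: (continuous_comp c2 c3).
move: jE; set q := chart_inv c _; rewrite gauss_spaceE => jE.
exists (k^-1 * (j * time_part (l q))).
  by rewrite mulr_gt0 ?invr_gt0 // mulr_gt0 // gauss_time_gt0.
by rewrite -[RHS]scalerA -[in RHS]scalerA -jE scalerA mulVf ?scale1r // gt_eqF.
Qed.

End GaussMap.

(** * Properness over the complement of the boundary at infinity *)

Section AtInfinity.
Context (R : realType) (n : nat) (M : topologicalType).
Context (phi : M -> 'rV[R]_n.+2) (G : M -> 'rV[R]_n.+1).
Hypothesis hphi : forall p, hyperbolic_space (phi p).
Hypothesis hproper : proper_in_hyperbolic_space phi.
Hypothesis hreg : regular_at_infinity phi G.

Lemma boundary_at_infinityP x : boundary_at_infinity phi x <->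
  sphere x /\ forall e : R, 0 < e -> exists q, `|poincare_ball (phi q) - x| < e.
Proof.
split=> [[sx [q qx]]|[sx hx]]; split => //.
  move=> e e0; have /cvgrPdist_lt/(_ e e0)[N _ /(_ N (leqnn N))] := qx.
  by rewrite distrC => ?; exists (q N).
have pos (j : nat) : 0 < (j.+1%:R : R)^-1 by rewrite invr_gt0.
have [q hq] : {q : nat -> M & forall j, `|poincare_ball (phi (q j)) - x| < j.+1%:R^-1}.
  apply: (@choice nat M (fun j q => `|poincare_ball (phi q) - x| < j.+1%:R^-1)) => j.
  exact: hx.
by exists q; exact: cvg_of_harmonic.
Qed.

Lemma boundary_at_infinity_closed : closed (boundary_at_infinity phi).
Proof.
move=> x clx; apply/boundary_at_infinityP; split.
  have clS : closed (@sphere R n).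
    apply: (@preimage_closed _ _ (@enorm R n.+1) [set 1]); last exact: closed_eq.
    by move=> y _; exact: continuous_enorm.
  by apply: clS => W nW; have [y [[sy _] Wy]] := clx W nW; exists y.
move=> e e0; have e20 : 0 < e / 2 by rewrite divr_gt0.
have [y [/boundary_at_infinityP[_ hy] xy]] := clx _ (nbhsx_ballx x _ e20).
have [q hq] := hy _ e20; exists q.
move: xy; rewrite -ball_normE /= distrC => xy.
have -> : poincare_ball (phi q) - x = (poincare_ball (phi q) - y) + (y - x).
  by rewrite addrA subrK.
by apply: (le_lt_trans (ler_normD _ _)); lra.
Qed.

Lemma boundary_at_infinity_compact : compact (boundary_at_infinity phi).
Proof.
apply: bounded_closed_compact; last exact: boundary_at_infinity_closed.
exists 1; split => // b b1 x [sx _].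
by apply: (le_trans (norm_le_enorm x)); rewrite sx ltW.
Qed.

(** The square is (t - 1) / (t + 1) with t the time part, so escape to infinity is approach to the
    unit sphere. *)
Lemma edot_poincare_ball (x : 'rV[R]_n.+2) : hyperbolic_space x ->
  edot (poincare_ball x) (poincare_ball x) = 1 - 2 / (1 + time_part x).
Proof.
move=> [xx x0]; rewrite /poincare_ball edotZl edotZr.
have -> : edot (space_part x) (space_part x) = time_part x ^+ 2 - 1.
  by move: xx; rewrite lorentz_split expr2; lra.
by field; rewrite gt_eqF // addr_gt0.
Qed.

Lemma hyperbolic_bounded_compact (T : R) :
  compact [set x : 'rV[R]_n.+2 | hyperbolic_space x /\ time_part x <= T].
Proof.
(* The open condition t > 0 is replaced by the closed one t >= 0, as t = 0 is impossible on the
   hyperboloid. *)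
have -> : [set x : 'rV[R]_n.+2 | hyperbolic_space x /\ time_part x <= T] =
    [set x | lorentz x x = -1] `&` ([set x | 0 <= time_part x] `&` [set x | time_part x <= T]).
  apply/seteqP; split => x /=; first by move=> [[xx x0] xT]; rewrite ltW.
  move=> [xx [x0 xT]]; do 2!split => //.
  rewrite lt_neqAle x0 andbT eq_sym; apply/eqP => t0.
  move: xx; rewrite lorentz_split t0 mulr0 oppr0 add0r.
  by have := edot_ge0 (space_part x); lra.
apply: bounded_closed_compact; last first.
  apply: closedI; last apply: closedI.
  - apply: (@preimage_closed _ _ (fun x : 'rV[R]_n.+2 => lorentz x x) [set -1]); last exact: closed_eq.
    by move=> x _; exact: (continuous_sbil_sqr (lorentz_symmetric_bilinear R n)).
  - apply: (@preimage_closed _ _ (@time_part R n) [set t | 0 <= t]); last exact: closed_ge.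
    by move=> x _; exact: continuous_time_part.
  - apply: (@preimage_closed _ _ (@time_part R n) [set t | t <= T]); last exact: closed_le.
    by move=> x _; exact: continuous_time_part.
exists T; split => [|b Tb x]; first exact: num_real.
move=> [/= xx [/= x0 /= xT]].
have b0 : 0 <= b by apply: (le_trans x0); apply: (le_trans xT); exact: ltW.
apply/rV_norm_le => // i; case: (unliftP ord0 i) => [j ->|->]; last first.
  by rewrite -/(time_part x) ger0_norm //; apply: (le_trans xT); exact: ltW.
have -> : x 0 (lift ord0 j) = space_part x 0 j by rewrite mxE.
apply: (le_trans (rV_coord_le _ _)); apply: (le_trans (norm_le_enorm _)).
rewrite -(@ler_pXn2r R 2) ?nnegrE ?enorm_ge0 // sqr_enorm.
have tb : time_part x <= b by apply: (le_trans xT); exact: ltW.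
have := ler_pM x0 x0 tb tb.
by move: xx; rewrite lorentz_split expr2; lra.
Qed.

(** Near [y] the time part of [phi] is bounded: otherwise points escape while [G] tends to [y], a
    subsequence converges in the ball to a boundary point [x], and regularity forces x = y. The
    filter then contains the preimage of a compact set, compact by properness of [phi]. *)
Lemma gauss_proper y : enorm y = 1 -> ~ boundary_at_infinity phi y ->
  forall F : set_system M, ProperFilter F -> G x @[x --> F] --> y ->
  cluster F !=set0.
Proof.
move=> y1 nEy F PF Fy.
have pos (j : nat) : 0 < (j.+1%:R : R)^-1 by rewrite invr_gt0.
have [T [d d0 hd]] : exists T, exists2 d : R, 0 < d &
    forall q, `|G q - y| < d -> time_part (phi q) <= T.
  apply: contrapT => nb; apply: nEy.
  have [q hq] : {q : nat -> M & forall k, `|G (q k) - y| < k.+1%:R^-1 /\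
      k.+1%:R < time_part (phi (q k))}.
    apply: (@choice nat M (fun k q => `|G q - y| < k.+1%:R^-1 /\ k.+1%:R < time_part (phi q))) => k.
    apply: contrapT => nk; apply: nb; exists k.+1%:R, k.+1%:R^-1 => // q qk.
    by rewrite leNgt; apply/negP => kq; apply: nk; exists q.
  pose b k := poincare_ball (phi (q k)).
  pose K := [set x : 'rV[R]_n.+1 | `|x| <= 1].
  have bE k : edot (b k) (b k) = 1 - 2 / (1 + time_part (phi (q k))).
    exact: edot_poincare_ball.
  have tpos k : 0 < time_part (phi (q k)) by case: (hphi (q k)).
  have Kb k : K (b k).
    apply: (le_trans (norm_le_enorm _)).
    rewrite -(@ler_pXn2r R 2) ?nnegrE ?enorm_ge0 // sqr_enorm bE expr1n.
    by rewrite lerBlDr lerDl divr_ge0 // addr_ge0 // ltW.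
  have cK : compact K.
    apply: bounded_closed_compact.
      by exists 1; split => // B B1 x; rewrite /K /= => x1; apply: (le_trans x1); exact: ltW.
    apply: (@preimage_closed _ _ (fun x : 'rV[R]_n.+1 => `|x|) [set t | t <= 1]); last exact: closed_le.
    by move=> x _; exact: norm_continuous.
  have [|x [_ clx]] := cK (b k @[k --> \oo]) _.
    by exists 0%N => // k _; exact: Kb.
  have sub (W : set 'rV[R]_n.+1) (N : nat) : nbhs x W -> exists2 k, (N <= k)%N & W (b k).
    move=> nW; have [|_ [[k Nk <-] Wk]] := clx [set b k | k in [set k | (N <= k)%N]] W _ nW.
      by exists N => // k Nk; exists k.
    by exists k.
  have sx : enorm x = 1.
    have : edot x x = 1.
      apply/eqP; rewrite -subr_eq0 -normr_le0; apply/ler_addgt0Pr => e e0; rewrite add0r.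
      have e20 : 0 < e / 2 by rewrite divr_gt0.
      have nW : nbhs x ((fun x : 'rV[R]_n.+1 => edot x x) @^-1` ball (edot x x) (e / 2)).
        by apply: continuous_edot_sqr; exact: nbhsx_ballx.
      have e40 : 0 < e / 4 by rewrite divr_gt0.
      have [N hN] := exists_natSinv_lt e40.
      have [k Nk] := sub _ N nW; rewrite -ball_normE /= bE => hk.
      have tk : 2 / (1 + time_part (phi (q k))) < e / 2.
        have h1 : N.+1%:R < time_part (phi (q k)).
          by apply: le_lt_trans (hq k).2; rewrite ler_nat.
        have h2 : (1 + time_part (phi (q k)))^-1 < N.+1%:R^-1.
          rewrite ltf_pV2 ?posrE ?ltr0n //; last by rewrite addr_gt0.
          by lra.
        have -> : e / 2 = 2 * (e / 4) by field.
        by rewrite ltr_pM2l //; exact: lt_trans h2 hN.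
      have t0 : 0 < 2 / (1 + time_part (phi (q k))) by rewrite divr_gt0 // addr_gt0.
      move: hk; rewrite ler_norml ltr_norml => /andP[h1 h2].
      by apply/andP; split; lra.
    by rewrite /enorm => ->; rewrite sqrtr1.
  (* The condition j <= s j makes [s] tend to infinity, so the estimates on [q] survive along it. *)
  have [s hs] : {s : nat -> nat & forall j, (j <= s j)%N /\ `|b (s j) - x| < j.+1%:R^-1}.
    apply: (@choice nat nat (fun j k => (j <= k)%N /\ `|b k - x| < j.+1%:R^-1)) => j.
    have [k jk hk] := sub _ j (nbhsx_ballx x _ (pos j)).
    by exists k; split => //; move: hk; rewrite -ball_normE /= distrC.
  have cvx : poincare_ball (phi (q (s j))) @[j --> \oo] --> x.
    by apply: cvg_of_harmonic => j; exact: (hs j).2.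
  have Ex : boundary_at_infinity phi x by split => //; exists (q \o s).
  have cvG : G (q (s j)) @[j --> \oo] --> x := hreg Ex cvx.
  have cvG' : G (q (s j)) @[j --> \oo] --> y.
    apply: cvg_of_harmonic => j; apply: (lt_le_trans (hq (s j)).1).
    by rewrite lef_pV2 ?posrE ?ltr0n // ler_nat ltnS; exact: (hs j).1.
  by rewrite -(cvg_unique _ cvG cvG').
pose K := [set x : 'rV[R]_n.+2 | hyperbolic_space x /\ time_part x <= T].
have cK : compact (phi @^-1` K).
  by apply: hproper; [move=> x []|exact: hyperbolic_bounded_compact].
have FK : F (phi @^-1` K).
  have Fb : F (G @^-1` ball y d) := Fy _ (nbhsx_ballx y _ d0).
  apply: filterS Fb => q.
  rewrite /preimage /= -ball_normE /= distrC => qd.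
  by split; [exact: hphi|exact: hd].
by have [x [_ clx]] := cK F PF FK; exists x.
Qed.

End AtInfinity.

Theorem theorem1p2 (R : realType) (n : nat) (hn : (3 <= n)%N)
  (M : topologicalType) (A : set (chart R n M))
  (hM : smooth_manifold A) (hconn : connected (@setT M))
  (phi eta : M -> 'rV[R]_n.+2) (G : M -> 'rV[R]_n.+1)
  (himm : immersion A phi) (hnormal : unit_normal_field A phi eta)
  (hproper : proper_in_hyperbolic_space phi)
  (hcomplete : complete_induced_metric A phi)
  (hconvex : uniformly_horospherically_convex A phi eta)
  (hG : is_gauss_map phi eta G)
  (hreg : regular_at_infinity phi G)
  (hdim : (hausdorff_dim (boundary_at_infinity phi) < (n%:R - 2)%R%:E)%E) :
  injective G.
Proof.
case: hM => hausM _ hA.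
have hphi : forall p, hyperbolic_space (phi p) by case: himm.
(* p = n - 2 is the exponent for [E]; the ambient space of the sphere has dimension p + 3, and n >=
   3 makes p positive. *)
have [p np] : exists p, n = p.+2 by exists n.-2; rewrite -[LHS](subnK (ltnW hn)) addn2 subn2.
subst n.
have p0 : (0 < p)%N by [].
apply: (injective_of_small_exceptional_set (E := boundary_at_infinity phi) p0 hausM hconn).
- by move=> x; have [] := hG x.
- exact: continuous_gauss hA himm hnormal hG.
- exact: gauss_locally_injective hA himm hnormal hG hconvex.
- exact: gauss_local_section hA himm hnormal hG hconvex.
- exact: gauss_proper hphi hproper hreg.
- by move=> e [].
- exact: boundary_at_infinity_closed.
- apply: hausdorff_dim_null_content; first exact: boundary_at_infinity_compact.
  by have -> : p%:R = p.+2%:R - 2 :> R by rewrite -addn2 natrD addrK.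
Qed.
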